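(* Let $k\geq 1$ be a fixed integer. For every integer $n\ge 2$ let $X_1,\ldots,X_n$ be i.i.d. random vectors distributed uniformly on $[0,1]^k$, let $E_{i,n}$ be the event that $X_i$ is a maximum of $\{X_1,\ldots,X_n\}$, and let $p_n=P(E_{1,n})$ and $e_n=P(E_{1,n}\cap E_{2,n})$. 1. For every $k\geq 1$ and every $n\ge 2$, $$e_n=\sum_{\substack{a,b,c,d\in\mathbb{Z}_+ :\\ a+b+c+d=n-2}}(-1)^{a+b}\,\frac{(n-2)!}{a!\,b!\,c!\,d!}\cdot\frac{(a+b+2c+2)^k-(b+c+1)^k-(a+c+1)^k}{(a+c+1)^k\,(b+c+1)^k\,(a+b+c+2)^k}.$$ 2. If $k>1$, then $$e_n\sim p_n^2\sim\left[\frac{\log^{k-1}(n)}{n\,(k-1)!}\right]^2\quad\text{as } n\to\infty,$$ and hence the correlation coefficient $\rho_{k,n}=\mathrm{Corr}(\mathbf{1}_{E_{1,n}},\mathbf{1}_{E_{2,n}})$ satisfies $$\rho_{k,n}=o\left(\frac{\log^{k-1}(n)}{n}\right)\quad\text{as } n\to\infty.$$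
   Context: $\prec$ is the product order on $\mathbb{R}^k$: $x\prec y$ if and only if $x_i\leq y_i$ for all $i\in\{1,\ldots,k\}$. The vector $X_i$ is a maximum of $\{X_1,\ldots,X_n\}$ if $X_i\not\prec X_j$ for every $j\in\{1,\ldots,n\}$ with $j\neq i$. $\mathbb{Z}_+$ is the set of nonnegative integers, $\mathbf{1}_E$ is the indicator of the event $E$, $\log^{r}(n)=(\log n)^{r}$, and $f(n)\sim g(n)$ means $f(n)/g(n)\to 1$. The parameter $k$ is fixed as $n\to\infty$. *)

(* Defs.v *)
From HB Require Import structures.
From mathcomp Require Import all_boot all_order all_algebra.
From mathcomp Require Import all_classical all_reals all_analysis.

Set Implicit Arguments.
Unset Strict Implicit.
Unset Printing Implicit Defensive.

Import Order.TTheory GRing.Theory Num.Theory.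
Import numFieldNormedType.Exports.

Local Open Scope classical_set_scope.
Local Open Scope ring_scope.

(* Vectors of [R^k] are [k.-tuple R], equipped by the library with the product
   sigma-algebra of the Borel sets of [R]. *)

Section uniform_cube.
Context {R : realType}.

(* [measurableTypeR R] is [R] with its Borel sets, the type on which
   [uniform_prob] is a measure. *)
Definition tuple_cons k (p : measurableTypeR R * k.-tuple R) : k.+1.-tuple R :=
  [tuple of (p.1 : R) :: p.2].

Lemma measurable_tuple_cons k : measurable_fun [set: _] (@tuple_cons k).
Proof.
apply: (@measurable_cons _ _ _ R fst k snd); last exact: measurable_snd.
exact: (@measurable_fst _ _ (measurableTypeR R) (k.-tuple R)).
Qed.

HB.instance Definition _ k :=
  isMeasurableFun.Build _ _ _ _ (@tuple_cons k) (@measurable_tuple_cons k).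

(* The uniform law on [[0,1]^k], i.e. the k-fold product of the uniform law on
   [[0,1]], transported from [R * k.-tuple R] to [k.+1.-tuple R] at each step. *)
Fixpoint uniform_cube k : probability (k.-tuple R) R :=
  if k is k'.+1 then
    distribution (uniform_prob (@ltr01 R) \x uniform_cube k')%E (@tuple_cons k')
  else \d_([tuple] : 0.-tuple R).

Lemma uniform_cube_box k (A : 'I_k -> set R) : (forall i, measurable (A i)) ->
  uniform_cube k [set x | forall i, A i (tnth x i)] =
  (\prod_(i < k) uniform_prob (@ltr01 R) (A i))%E.
Proof.
elim: k A => [|k IHk] A mA.
  by rewrite big_ord0 /= diracE mem_set// => -[].
rewrite big_ord_recl /= /distribution /pushforward.
have -> : @tuple_cons k @^-1` [set x | forall i, A i (tnth x i)] =
    A ord0 `*` [set x | forall i, A (lift ord0 i) (tnth x i)].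
  apply/seteqP; split => -[a t] /=.
    by move=> At; split => [|i]; [exact: (At ord0)|have := At (lift ord0 i); rewrite tnthS].
  move=> [Aa At] i; have [j ->|->//] := unliftP ord0 i.
  by rewrite tnthS; exact: At.
have mB : measurable
    [set x : k.-tuple R | forall i, A (lift ord0 i) (tnth x i)].
  rewrite (_ : mkset _ = \bigcap_(i in [set: 'I_k])
      ((@tnth k R ^~ i) @^-1` A (lift ord0 i))); last first.
    by apply/seteqP; split => x /= Ax i; [move=> _|]; exact: Ax.
  apply: fin_bigcap_measurable => [|i _]; first exact: finite_finset.
  by rewrite -[X in measurable X]setTI; exact: measurable_tnth.
rewrite product_measure1E//; [congr (_ * _)%E; exact: IHk|exact: mA].
Qed.

End uniform_cube.

Section iid.
Context {d d' : measure_display} {T : measurableType d} {T' : measurableType d'}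
  {R : realType}.

Definition mutually_independent (P : probability T R) (n : nat)
    (X : nat -> T -> T') : Prop :=
  forall (J : seq nat) (A : nat -> set T'),
    uniq J -> {subset J <= iota 1 n} -> (forall i, measurable (A i)) ->
    P (\bigcap_(i in [set` J]) (X i @^-1` A i)) =
    (\prod_(i <- J) P (X i @^-1` A i))%E.

Definition has_law (P : probability T R) (X : {RV P >-> T'})
    (Q : probability T' R) : Prop :=
  forall A, measurable A -> distribution P X A = Q A.

End iid.

(* Only [X 1, ..., X n] matter. *)
Definition iid_uniform_cube {d : measure_display} {T : measurableType d}
    {R : realType} (P : probability T R) (n k : nat)
    (X : nat -> {RV P >-> k.-tuple R}) : Prop :=
  mutually_independent P n X /\
  (forall i, (1 <= i <= n)%N -> has_law (X i) (uniform_cube k)).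

Section maxima.
Context {R : realType} {k : nat}.

Definition prec (x y : k.-tuple R) : Prop :=
  forall c : 'I_k, tnth x c <= tnth y c.

(* The event that [X i] is a maximum of [{X 1, ..., X n}]. *)
Definition max_event {T : Type} (X : nat -> T -> k.-tuple R) (n i : nat) : set T :=
  [set w | forall j, (1 <= j <= n)%N -> j != i -> ~ prec (X i w) (X j w)].

End maxima.

Definition corr {d : measure_display} {T : measurableType d} {R : realType}
    (P : probability T R) (U V : T -> R) : R :=
  fine (covariance P U V) /
  (Num.sqrt (fine (variance P U)) * Num.sqrt (fine (variance P V))).

Definition asymp_equiv {R : realType} (f g : nat -> R) : Prop :=
  (f n / g n) @[n --> \oo] --> (1 : R).

(* Main.v *)
From HB Require Import structures.
Require Import Defs.
From mathcomp Require Import all_boot all_order all_algebra.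
From mathcomp Require Import all_classical all_reals all_analysis.
From mathcomp Require Import measurable_realfun ring lra zify.

Set Implicit Arguments.
Unset Strict Implicit.
Unset Printing Implicit Defensive.

Import Order.TTheory GRing.Theory Num.Theory.
Import numFieldNormedType.Exports.

Local Open Scope classical_set_scope.
Local Open Scope ring_scope.

(* For [x] in the cube put [U x = \prod_i (1 - x_i)], the measure of the points
   above [x], and [W x y] the measure of the points above both [x] and [y]. By
   Fubini, [p_n] is the integral of [(1 - U x)^(n-1)] and [e_n] that of
   [(1 - U x - U y + W x y)^(n-2)] over incomparable pairs. Multinomial
   expansion and the factorization of the moments of [(U x, U y, W x y)] over
   the coordinates give the formula for [e_n].
   For the asymptotics, [n p_n] in dimension [k] is the sum over [m <= n] of
   [p_m] in dimension [k - 1], hence a nested harmonic sum, which is compared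
   with [(ln n)^(k-1) / (k-1)!]. Since [U x U y <= W x y], removing the
   comparable pairs gives [e_n >= p_(n-1)^2 - 2 (p_(n-1) - p_n)]. Conversely
   [e_n - p_(n-1)^2] is at most [n] times the integral of
   [W x y ((1 - U x) (1 - U y))^h] with [h] close to [n / 2]; bounding the
   first factor of [W] by one point and the others by the other point, it is of
   the order of [p_n] in dimension [k - 1] times [p_n] in dimension [k], one
   logarithm less than [p_n^2]. *)

(** * Expectations of bounded measurable functions *)

(** The delicate point is the upper bound. Estimating [W x y] by [U x] alone would split the error
    over the two points into something of order [n (p_n / n) p_n], as large as [p_n^2] itself.
    Taking one factor of [W] from the other point leaves an integral in dimension [k - 1] for that
    point: this gains the missing logarithm and gives a relative error of order [1 / ln n]. The
    lower bound has more room: the comparable pairs cost at most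
    [2 (p_(n-1) - p_n) <= 2 p_n / (n - 1)], of relative order [1 / (ln n)^(k-1)]. This tends to [0]
    because [k > 1]; for [k = 1] two points are almost surely comparable. Everything needed about
    [p_n] comes from a recursion on the dimension and the exponent, obtained from the binomial
    expansion, so no integral has to be expanded asymptotically. Both bounds on [e_n / p_n^2] have
    explicit constants for every [n >= 2], and the limits follow by squeezing. *)

Section bounded_measurable.
Context {d : measure_display} {T : measurableType d} {R : realType}.
Implicit Types f g : T -> R.

(** One condition serves as side condition throughout: it implies integrability under every
    probability, and it is stable under sums, products, powers, sections and partial integration.
    Linearity and Fubini then never need a separate integrability argument. *)
Definition bmeas f : Prop :=
  measurable_fun [set: T] f /\ exists M, forall x, `|f x| <= M.

Lemma bmeas_cst (c : R) : bmeas (fun=> c).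
Proof. by split; [exact: measurable_cst|exists `|c|]. Qed.

Lemma bmeasD f g : bmeas f -> bmeas g -> bmeas (fun x => f x + g x).
Proof.
move=> [mf [M fM]] [mg [N gN]]; split; first exact: measurable_funD.
by exists (M + N) => x; rewrite (le_trans (ler_normD _ _))// lerD.
Qed.

Lemma bmeasN f : bmeas f -> bmeas (fun x => - f x).
Proof.
move=> [mf [M fM]]; split; last by exists M => x; rewrite normrN.
exact: measurableT_comp.
Qed.

Lemma bmeasB f g : bmeas f -> bmeas g -> bmeas (fun x => f x - g x).
Proof. by move=> bf bg; apply: bmeasD => //; exact: bmeasN. Qed.

Lemma bmeasM f g : bmeas f -> bmeas g -> bmeas (fun x => f x * g x).
Proof.
move=> [mf [M fM]] [mg [N gN]]; split; first exact: measurable_funM.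
by exists (M * N) => x; rewrite normrM ler_pM.
Qed.

Lemma bmeasX f n : bmeas f -> bmeas (fun x => f x ^+ n).
Proof.
move=> bf; elim: n => [|n IHn].
  by under eq_fun do rewrite expr0; exact: bmeas_cst.
by under eq_fun do rewrite exprS; exact: bmeasM.
Qed.

Lemma bmeas_sum (I : Type) (s : seq I) (Q : pred I) (F : I -> T -> R) :
  (forall i, bmeas (F i)) -> bmeas (fun x => \sum_(i <- s | Q i) F i x).
Proof.
move=> bF; elim: s => [|i s IHs].
  by under eq_fun do rewrite big_nil; exact: bmeas_cst.
under eq_fun do rewrite big_cons; case: (Q i) => //.
exact: bmeasD.
Qed.

Lemma bmeas_prod (I : Type) (s : seq I) (F : I -> T -> R) :
  (forall i, bmeas (F i)) -> bmeas (fun x => \prod_(i <- s) F i x).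
Proof.
move=> bF; elim: s => [|i s IHs].
  by under eq_fun do rewrite big_nil; exact: bmeas_cst.
by under eq_fun do rewrite big_cons; exact: bmeasM.
Qed.

Lemma bmeas_indic (A : set T) : measurable A -> bmeas (\1_A).
Proof.
move=> mA; split; first exact: measurable_indic.
by exists 1 => x; rewrite indicE; case: (_ \in _); rewrite ?normr1 ?normr0.
Qed.

Lemma bmeas_integrable (P : probability T R) f :
  bmeas f -> P.-integrable [set: T] (EFin \o f).
Proof.
move=> [mf [M fM]]; apply: measurable_bounded_integrable => //.
  by rewrite (le_lt_trans (probability_le1 _ _))// ltry.
exists M; split; first exact: num_real.
by move=> x Mx y _; exact: le_trans (fM y) (ltW Mx).
Qed.

Definition mean (P : probability T R) f : R := \int[P]_x f x.

Variable P : probability T R.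

Lemma EFin_mean f : bmeas f -> (mean P f)%:E = (\int[P]_x (f x)%:E)%E.
Proof.
move=> bf; rewrite /mean /Rintegral fineK//.
by apply: integrable_fin_num => //; exact: bmeas_integrable.
Qed.

Lemma eq_mean f g : f =1 g -> mean P f = mean P g.
Proof. by move=> fg; apply: eq_Rintegral => x _; exact: fg. Qed.

Lemma mean_cst c : mean P (fun=> c) = c.
Proof.
rewrite /mean Rintegral_cst//.
by have := probability_setT P => /= ->; rewrite mulr1.
Qed.

Lemma meanD f g : bmeas f -> bmeas g ->
  mean P (fun x => f x + g x) = mean P f + mean P g.
Proof. by move=> bf bg; rewrite /mean RintegralD//; exact: bmeas_integrable. Qed.

Lemma meanB f g : bmeas f -> bmeas g ->
  mean P (fun x => f x - g x) = mean P f - mean P g.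
Proof. by move=> bf bg; rewrite /mean RintegralB//; exact: bmeas_integrable. Qed.

Lemma meanZl c f : bmeas f -> mean P (fun x => c * f x) = c * mean P f.
Proof. by move=> bf; rewrite /mean RintegralZl//; exact: bmeas_integrable. Qed.

Lemma meanZr c f : bmeas f -> mean P (fun x => f x * c) = mean P f * c.
Proof. by move=> bf; rewrite /mean RintegralZr//; exact: bmeas_integrable. Qed.

Lemma le_mean f g : bmeas f -> bmeas g -> (forall x, f x <= g x) ->
  mean P f <= mean P g.
Proof.
by move=> bf bg fg; apply: le_Rintegral => //; exact: bmeas_integrable.
Qed.

Lemma mean_ge0 f : (forall x, 0 <= f x) -> 0 <= mean P f.
Proof. by move=> f0; apply: Rintegral_ge0 => x _. Qed.

Lemma mean_sum (I : Type) (s : seq I) (Q : pred I) (F : I -> T -> R) :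
  (forall i, bmeas (F i)) ->
  mean P (fun x => \sum_(i <- s | Q i) F i x) =
  \sum_(i <- s | Q i) mean P (F i).
Proof.
move=> bF; elim: s => [|i s IHs].
  by under eq_mean do rewrite big_nil; rewrite mean_cst big_nil.
under eq_mean do rewrite big_cons; rewrite big_cons; case: (Q i) => //.
by rewrite meanD ?IHs//; exact: bmeas_sum.
Qed.

Lemma mean_indic (A : set T) : measurable A -> mean P (\1_A) = fine (P A).
Proof. by move=> mA; rewrite /mean /Rintegral integral_indic// setIT. Qed.

End bounded_measurable.

Lemma bmeas_comp {d1 d2} {T1 : measurableType d1} {T2 : measurableType d2}
    {R : realType} (f : T2 -> R) (h : T1 -> T2) :
  measurable_fun setT h -> bmeas f -> bmeas (fun x => f (h x)).
Proof.
move=> mh [mf [M fM]]; split; first exact: measurableT_comp.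
by exists M => x; exact: fM.
Qed.

Lemma mean_distribution {d1 d2} {T1 : measurableType d1}
    {T2 : measurableType d2} {R : realType} (P : probability T1 R)
    (X : {mfun T1 >-> T2}) (f : T2 -> R) : bmeas f ->
  mean (distribution P X) f = mean P (fun x => f (X x)).
Proof.
move=> bf; apply: EFin_inj.
rewrite !EFin_mean//; last by apply: (bmeas_comp _ bf).
rewrite integral_distribution//; first by apply/measurable_EFinP; case: bf.
by apply: (bmeas_integrable _ (f := fun x => f (X x))); exact: bmeas_comp.
Qed.

Lemma eq_mean_prob {d} {T : measurableType d} {R : realType}
    (P Q : probability T R) (f : T -> R) :
  (forall A, measurable A -> P A = Q A) -> mean P f = mean Q f.
Proof. by move=> PQ; congr fine; apply: eq_measure_integral => A mA _; exact: PQ. Qed.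

(** * Fubini for bounded measurable functions *)

Section product_mean.
Context {d1 d2 : measure_display} {T1 : measurableType d1}
  {T2 : measurableType d2} {R : realType}.
Variables (P1 : probability T1 R) (P2 : probability T2 R).

Lemma bmeas_fst (f : T1 -> R) :
  bmeas f -> bmeas (fun z : T1 * T2 => f z.1).
Proof. exact: bmeas_comp. Qed.

Lemma bmeas_snd (f : T2 -> R) :
  bmeas f -> bmeas (fun z : T1 * T2 => f z.2).
Proof. exact: bmeas_comp. Qed.

Variable f : T1 * T2 -> R.
Hypothesis bf : bmeas f.

Lemma bmeas_sectionl x : bmeas (fun y => f (x, y)).
Proof. by apply: bmeas_comp bf; exact: measurable_pair1. Qed.

Lemma bmeas_sectionr y : bmeas (fun x => f (x, y)).
Proof. by apply: bmeas_comp bf; exact: measurable_pair2. Qed.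

Lemma bmeas_meanl : bmeas (fun x => mean P2 (fun y => f (x, y))).
Proof.
split.
  apply/measurable_EFinP.
  rewrite (_ : _ \o _ = (fun x => \int[P2]_y (f (x, y))%:E)%E).
    exact: (measurable_fubini_F (f := EFin \o f) (bmeas_integrable _ bf)).
  by apply/funext => x /=; rewrite EFin_mean//; exact: bmeas_sectionl.
have [_ [M fM]] := bf.
exists M => x; rewrite ler_norml -[X in X <= _](mean_cst P2) -[X in _ && (_ <= X)](mean_cst P2).
have bx := bmeas_sectionl x.
have fM' y : - M <= f (x, y) <= M by rewrite -ler_norml.
by apply/andP; split; apply: le_mean => //; try exact: bmeas_cst;
   move=> y; case/andP: (fM' y).
Qed.

Lemma mean_fubini : mean (P1 \x P2)%E f = mean P1 (fun x => mean P2 (fun y => f (x, y))).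
Proof.
apply: EFin_inj; rewrite !EFin_mean//; last exact: bmeas_meanl.
rewrite -(integral12_prod_meas1 (bmeas_integrable _ bf)).
by apply: eq_integral => x _; rewrite EFin_mean//; exact: bmeas_sectionl.
Qed.

End product_mean.

Lemma mean_exchange {d1 d2} {T1 : measurableType d1}
    {T2 : measurableType d2} {R : realType}
    (P1 : probability T1 R) (P2 : probability T2 R) (f : T1 * T2 -> R) :
  bmeas f ->
  mean P1 (fun x => mean P2 (fun y => f (x, y))) =
  mean P2 (fun y => mean P1 (fun x => f (x, y))).
Proof.
move=> bf.
have bg : bmeas (fun z => f (z.2, z.1)).
  by apply: (bmeas_comp (h := fun z : T2 * T1 => (z.2, z.1))) bf; exact: measurable_swap.
apply: EFin_inj.
rewrite EFin_mean; last exact: bmeas_meanl.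
rewrite EFin_mean; last exact: (bmeas_meanl P2 P1 bg).
under eq_integral do rewrite (EFin_mean _ (bmeas_sectionl bf _)).
under [RHS]eq_integral do rewrite (EFin_mean _ (bmeas_sectionr bf _)).
exact: (Fubini (bmeas_integrable _ bf)).
Qed.

(** * Joint law of independent variables *)

Section tuple_law.
Context {d : measure_display} {S : measurableType d} {R : realType}.

Lemma bmeas_tnth n (i : 'I_n) (f : S -> R) :
  bmeas f -> bmeas (fun t : n.-tuple S => f (tnth t i)).
Proof. by apply: bmeas_comp; exact: measurable_tnth. Qed.

Definition tcons n (z : S * n.-tuple S) : n.+1.-tuple S := [tuple of z.1 :: z.2].

Lemma measurable_tcons n : measurable_fun [set: _] (@tcons n).
Proof. by apply: measurable_cons; [exact: measurable_fst|exact: measurable_snd]. Qed.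

HB.instance Definition _ n :=
  isMeasurableFun.Build _ _ _ _ (@tcons n) (@measurable_tcons n).

Fixpoint power_prob (mu : probability S R) n : probability (n.-tuple S) R :=
  if n is n'.+1 then distribution (mu \x power_prob mu n')%E (@tcons n')
  else \d_([tuple] : 0.-tuple S).

Variable mu : probability S R.

Lemma bmeas_tcons n (f : n.+1.-tuple S -> R) : bmeas f -> bmeas (f \o @tcons n).
Proof. by apply: bmeas_comp; exact: measurable_tcons. Qed.

Lemma mean_power_cons n (f : n.+1.-tuple S -> R) : bmeas f ->
  mean (power_prob mu n.+1) f =
  mean mu (fun x => mean (power_prob mu n) (fun t => f (tcons (x, t)))).
Proof.
by move=> bf; rewrite mean_distribution// (mean_fubini _ _ (bmeas_tcons bf)).
Qed.

Lemma mean_power0 (f : 0.-tuple S -> R) : mean (power_prob mu 0) f = f [tuple].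
Proof.
transitivity (mean (power_prob mu 0) (fun=> f [tuple])); last exact: mean_cst.
by apply: eq_mean => t; rewrite (tuple0 t).
Qed.

Lemma tnth_tcons0 n x (t : n.-tuple S) : tnth (tcons (x, t)) ord0 = x.
Proof. exact: tnth0. Qed.

Lemma tnth_tconsS n x (t : n.-tuple S) i :
  tnth (tcons (x, t)) (lift ord0 i) = tnth t i.
Proof. exact: tnthS. Qed.

Lemma mean_power_prod n (h : 'I_n -> S -> R) : (forall i, bmeas (h i)) ->
  mean (power_prob mu n) (fun t => \prod_(i < n) h i (tnth t i)) =
  \prod_(i < n) mean mu (h i).
Proof.
elim: n h => [|n IHn] h bh; first by rewrite mean_power0 !big_ord0.
rewrite mean_power_cons; last first.
  by apply: bmeas_prod => i; apply: bmeas_tnth.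
rewrite big_ord_recl -IHn// -meanZr//; apply: eq_mean => x.
under eq_mean do rewrite big_ord_recl tnth_tcons0.
rewrite meanZl; last first.
  by apply: bmeas_prod => i; under eq_fun do rewrite tnth_tconsS; apply: bmeas_tnth.
congr (_ * _); apply: eq_mean => t.
by apply: eq_bigr => i _; rewrite tnth_tconsS.
Qed.

End tuple_law.

Section joint_law.
Context {d d' : measure_display} {T : measurableType d} {S : measurableType d'}
  {R : realType}.

Definition box n (B : nat -> set S) : set (n.-tuple S) :=
  [set t | forall i : 'I_n, B i (tnth t i)].

Lemma indic_box n (B : nat -> set S) :
  \1_(@box n B) = (fun t => \prod_(i < n) \1_(B i) (tnth t i)) :> (_ -> R).
Proof.
apply/funext => t; rewrite indicE.
have [tB|tB] := pselect (box B t).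
  by rewrite mem_set// big1// => i _; rewrite indicE mem_set//; exact: tB.
rewrite memNset//; have /existsNP[i Bi] := tB.
by rewrite (bigD1 i)//= indicE memNset// mul0r.
Qed.

Lemma measurable_box n (B : nat -> set S) :
  (forall i, measurable (B i)) -> measurable (@box n B).
Proof.
move=> mB; apply/(measurable_indicP R); rewrite indic_box.
apply: (proj1 (bmeas_prod _ _)) => i.
by apply: bmeas_tnth; exact: bmeas_indic.
Qed.

(** Boxes generate the product sigma-algebra and are stable under intersection, which the coordinate
    cylinders alone are not. This is the form that uniqueness of measures requires in
    [joint_law]. *)
Lemma measurable_tupleE n :
  (measurable : set (set (n.-tuple S))) =
  <<s [set A | exists2 B : nat -> set S, (forall i, measurable (B i)) & A = box B] >>.
Proof.
apply/seteqP; split; last first.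
  apply: smallest_sub; first exact: sigma_algebra_measurable.
  by move=> _ [B mB ->]; exact: measurable_box.
apply: smallest_sub; first exact: smallest_sigma_algebra.
move=> A; rewrite -bigcup_seq => -[i /= _ [C mC <-]].
apply: sub_sigma_algebra.
exists (fun j => if j == i :> nat then C else setT).
  by move=> j; case: ifP => // _; exact: measurableT.
apply/seteqP; split => t /=.
  by move=> [_ Ct] j; case: eqP => // /val_inj ->.
by move=> /(_ i); rewrite eqxx.
Qed.

Lemma power_prob_box (mu : probability S R) n (B : nat -> set S) :
  (forall i, measurable (B i)) ->
  (power_prob mu n (box B) = \prod_(i < n) mu (B i))%E.
Proof.
move=> mB; rewrite -[LHS]fineK; last first.
  by rewrite fin_num_measure//; exact: measurable_box.
rewrite -mean_indic; last exact: measurable_box.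
rewrite indic_box (mean_power_prod mu (h := fun i : 'I_n => \1_(B i))) => [|i]; last first.
  exact: bmeas_indic.
rewrite -prodEFin; apply: eq_bigr => i _.
by rewrite mean_indic// fineK// fin_num_measure.
Qed.

Variable P : probability T R.

(** The sample is numbered from 1 and tuples from 0: coordinates [ord0] and [lift ord0 ord0] carry
    [X 1] and [X 2]. *)
Definition joint n (X : nat -> {RV P >-> S}) (w : T) : n.-tuple S :=
  [tuple X i.+1 w | i < n].

Lemma measurable_joint n X : measurable_fun [set: T] (@joint n X).
Proof.
apply/measurable_fun_tnthP => i.
rewrite (_ : _ \o _ = X i.+1); last by apply/funext => w /=; rewrite tnth_mktuple.
exact: measurable_funPT.
Qed.

HB.instance Definition _ n X :=
  isMeasurableFun.Build _ _ _ _ (@joint n X) (@measurable_joint n X).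

(** Independence for the full index list [iota 1 n] says that the two measures agree on boxes, and
    boxes form a generating pi-system. From here on, probabilities of the sample are iterated
    integrals. *)
Lemma joint_law n (X : nat -> {RV P >-> S}) (mu : probability S R) :
  mutually_independent P n X ->
  (forall i, (1 <= i <= n)%N -> has_law (X i) mu) ->
  forall A, measurable A -> distribution P (@joint n X) A = power_prob mu n A.
Proof.
move=> indep law A mA.
apply: (measure_unique _ (fun=> setT) (measurable_tupleE n)) => //.
- move=> _ _ [B mB ->] [C mC ->]; exists (fun i => B i `&` C i).
    by move=> i; exact: measurableI.
  apply/seteqP; split => t /=; first by move=> [tB tC] i; split; [exact: tB|exact: tC].
  by move=> tBC; split => i; have [] := tBC i.
- move=> _; exists (fun=> setT); first by move=> _; exact: measurableT.
  by apply/seteqP; split.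
- exact: bigcup_const.
- move=> _ [B mB ->]; apply: etrans (esym (power_prob_box mu n mB)).
  rewrite /= /distribution /pushforward.
  rewrite (_ : _ @^-1` _ =
      \bigcap_(i in [set` iota 1 n]) (X i @^-1` B i.-1)); last first.
    apply/seteqP; split => w /= Bw.
      move=> i /=; rewrite mem_iota add1n ltnS => /andP[i0 ilen].
      have ilt : (i.-1 < n)%N by rewrite prednK.
      by have := Bw (Ordinal ilt); rewrite tnth_mktuple /= prednK.
    move=> i; rewrite tnth_mktuple; apply: (Bw i.+1) => /=.
    by rewrite mem_iota /= add1n ltnS.
  rewrite (indep _ (fun i => B i.-1))//; last exact: iota_uniq.
  have -> : iota 1 n = index_iota 1 n.+1 by rewrite /index_iota subn1.
  rewrite big_add1 /= big_mkord.
  by apply: eq_bigr => i _; apply: law; rewrite /= ?ltn_ord.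
- by move=> _; rewrite (le_lt_trans (probability_le1 _ _))// ltry.
Qed.

Lemma mean_joint n (X : nat -> {RV P >-> S}) (mu : probability S R)
    (F : n.-tuple S -> R) :
  mutually_independent P n X ->
  (forall i, (1 <= i <= n)%N -> has_law (X i) mu) -> bmeas F ->
  mean P (fun w => F (joint n X w)) = mean (power_prob mu n) F.
Proof.
move=> indep law bF; rewrite -(eq_mean_prob _ (joint_law indep law)).
by rewrite mean_distribution.
Qed.

End joint_law.

(** * Probabilities that one or two given points are maximal *)

Section maximal_events.
Context {d d' : measure_display} {T : measurableType d} {S : measurableType d'}
  {R : realType}.
Variable P : probability T R.
Implicit Types X : nat -> {RV P >-> S}.

Lemma bmeas_indicP (A : set T) (f : T -> R) :
  (forall w, \1_A w = f w) -> bmeas f -> measurable A.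
Proof. by move=> /funext Af [mf _]; apply/(measurable_indicP R); rewrite Af. Qed.

Variable r : S -> S -> bool.
Let rR (x y : S) : R := (r x y)%:R.
Hypothesis br : bmeas (fun z => rR z.1 z.2).

Lemma bmeas_rel d2 (U : measurableType d2) (f g : U -> S) :
  measurable_fun [set: U] f -> measurable_fun [set: U] g ->
  bmeas (fun u => rR (f u) (g u)).
Proof.
move=> mf mg; apply: (bmeas_comp (h := fun u => (f u, g u))) br.
exact: measurable_fun_pair.
Qed.

(** The version of [max_event] for a boolean relation on any space. Its indicator is a finite
    product of factors [1 - rR], which yields both measurability and the factorization of its
    mean. *)
Definition maximal X n i : set T :=
  [set w | forall j, (1 <= j <= n)%N -> j != i -> ~ r (X i w) (X j w)].

Let F1 n (t : n.+1.-tuple S) : R :=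
  \prod_(j < n) (1 - rR (tnth t ord0) (tnth t (lift ord0 j))).

Let F2 n (t : n.+2.-tuple S) : R :=
  (1 - rR (tnth t ord0) (tnth t (lift ord0 ord0))) *
  (1 - rR (tnth t (lift ord0 ord0)) (tnth t ord0)) *
  \prod_(j < n) ((1 - rR (tnth t ord0) (tnth t (lift ord0 (lift ord0 j)))) *
     (1 - rR (tnth t (lift ord0 ord0)) (tnth t (lift ord0 (lift ord0 j))))).

Let bmeas_1rel d2 (U : measurableType d2) (f g : U -> S) :
  measurable_fun [set: U] f -> measurable_fun [set: U] g ->
  bmeas (fun u => 1 - rR (f u) (g u)).
Proof. by move=> mf mg; apply: bmeasB; [exact: bmeas_cst|exact: bmeas_rel]. Qed.

Let bmeas_F1 n : bmeas (@F1 n).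
Proof. by apply: bmeas_prod => j; apply: bmeas_1rel; exact: measurable_tnth. Qed.

Let bmeas_F2 n : bmeas (@F2 n).
Proof.
apply: bmeasM; first by apply: bmeasM; apply: bmeas_1rel; exact: measurable_tnth.
by apply: bmeas_prod => j; apply: bmeasM; apply: bmeas_1rel; exact: measurable_tnth.
Qed.

Let rRN x y : 1 - rR x y = (~~ r x y)%:R.
Proof. by rewrite /rR; case: (r x y); rewrite ?subrr ?subr0. Qed.

Let indic_maximal1 X n w : \1_(maximal X n.+1 1) w = F1 (joint n.+1 X w).
Proof.
rewrite indicE /F1 tnth_mktuple /=.
under eq_bigr do rewrite tnth_mktuple lift0.
have [Aw|Aw] := pselect (maximal X n.+1 1 w).
  rewrite mem_set// big1// => j _; rewrite rRN (_ : ~~ _)//.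
  by apply/negP; apply: Aw => //; exact: (ltn_ord (lift ord0 j)).
rewrite memNset//; have /existsNP[j] := Aw.
move=> /not_implyP[jn] /not_implyP[j1] /contrapT rj.
have j1n : (j.-2 < n)%N by case: j jn j1 {rj} => [|[|j]].
rewrite (bigD1 (Ordinal j1n))//= rRN.
have -> : j.-2.+2 = j by case: j jn j1 {rj j1n} => [|[|j]].
by rewrite rj mul0r.
Qed.

Let indic_maximal12 X n w :
  \1_(maximal X n.+2 1 `&` maximal X n.+2 2) w = F2 (joint n.+2 X w).
Proof.
rewrite indicE /F2 !tnth_mktuple /=.
under eq_bigr do rewrite tnth_mktuple !lift0 !rRN.
rewrite !rRN (_ : bump 0 0 = 1%N)//.
have [[A1 A2]|Aw] := pselect ((maximal X n.+2 1 `&` maximal X n.+2 2) w).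
  rewrite mem_set//.
  have -> : ~~ r (X 1%N w) (X 2%N w) by apply/negP; apply: A1.
  have -> : ~~ r (X 2%N w) (X 1%N w) by apply/negP; apply: A2.
  rewrite big1 ?mulr1// => j _.
  have -> : ~~ r (X 1%N w) (X j.+3 w).
    by apply/negP; apply: A1 => //; exact: (ltn_ord (lift ord0 (lift ord0 j))).
  have -> : ~~ r (X 2%N w) (X j.+3 w).
    by apply/negP; apply: A2 => //; exact: (ltn_ord (lift ord0 (lift ord0 j))).
  by rewrite mulr1.
rewrite memNset//.
have /not_andP[|] := Aw => /existsNP[j] /not_implyP[jn] /not_implyP[j1] /contrapT rj.
  have [j2|j2] := eqVneq j 2%N.
    by rewrite -j2 rj !mul0r.
  have j1n : (j.-1.-2 < n)%N by case: j jn j1 j2 {rj} => [|[|[|j]]].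
  rewrite (bigD1 (Ordinal j1n))//=.
  have -> : j.-1.-2.+3 = j.
    by case: j jn j1 j2 {rj j1n} => [|[|[|j]]].
  by rewrite rj !(mul0r, mulr0).
have [j2|j2] := eqVneq j 1%N.
  by move: rj; rewrite j2 => ->; rewrite !(mul0r, mulr0).
have j1n : (j.-1.-2 < n)%N by case: j jn j1 j2 {rj} => [|[|[|j]]].
rewrite (bigD1 (Ordinal j1n))//=.
have -> : j.-1.-2.+3 = j.
  by case: j jn j1 j2 {rj j1n} => [|[|[|j]]].
by rewrite rj !(mul0r, mulr0).
Qed.

Lemma measurable_maximal1 X n : (0 < n)%N -> measurable (maximal X n 1).
Proof.
case: n => // n _; apply: (bmeas_indicP (indic_maximal1 X n)).
exact: (bmeas_comp (measurable_joint X) (bmeas_F1 n)).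
Qed.

Variable mu : probability S R.

Lemma prob_maximal1 X n :
  mutually_independent P n.+1 X ->
  (forall i, (1 <= i <= n.+1)%N -> has_law (X i) mu) ->
  fine (P (maximal X n.+1 1)) =
  mean mu (fun x => (1 - mean mu (rR x)) ^+ n).
Proof.
move=> indep law; rewrite -mean_indic; last exact: measurable_maximal1.
rewrite (eq_mean _ (indic_maximal1 X n)) (mean_joint indep law)//.
rewrite mean_power_cons//; apply: eq_mean => x.
transitivity (mean (power_prob mu n)
    (fun t => \prod_(j < n) (fun z => 1 - rR x z) (tnth t j))).
  apply: eq_mean => t; rewrite /F1 tnth_tcons0.
  by apply: eq_bigr => j _; rewrite tnth_tconsS.
have bx : bmeas (rR x) by apply: bmeas_rel => //; exact: measurable_cst.
rewrite (mean_power_prod mu (h := fun (_ : 'I_n) z => 1 - rR x z)); last first.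
  by move=> _; apply: bmeasB => //; exact: bmeas_cst.
rewrite prodr_const card_ord meanB ?mean_cst//; exact: bmeas_cst.
Qed.

(** Given the first two points [x] and [y], neither may lie below the other, and each of the [n]
    remaining points must independently avoid being above [x] and being above [y].
    Inclusion-exclusion gives the base of the power. *)
Lemma prob_maximal12 X n :
  mutually_independent P n.+2 X ->
  (forall i, (1 <= i <= n.+2)%N -> has_law (X i) mu) ->
  fine (P (maximal X n.+2 1 `&` maximal X n.+2 2)) =
  mean mu (fun x => mean mu (fun y => (1 - rR x y) * (1 - rR y x) *
    (1 - mean mu (rR x) - mean mu (rR y) +
       mean mu (fun z => rR x z * rR y z)) ^+ n)).
Proof.
move=> indep law; rewrite -mean_indic; last first.
  apply: (bmeas_indicP (indic_maximal12 X n)).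
  exact: (bmeas_comp (measurable_joint X) (bmeas_F2 n)).
rewrite (eq_mean _ (indic_maximal12 X n)) (mean_joint indep law)//.
rewrite mean_power_cons//; apply: eq_mean => x.
rewrite mean_power_cons; last first.
  apply: bmeas_comp (bmeas_F2 n).
  apply: (measurableT_comp (measurable_tcons (n := n.+1))).
  exact: measurable_pair1.
apply: eq_mean => y.
have b1 : bmeas (fun _ : S => 1 : R) by exact: bmeas_cst.
have bx x' : bmeas (rR x') by apply: bmeas_rel => //; exact: measurable_cst.
have bt x' : bmeas (fun z => 1 - rR x' z) by exact: bmeasB.
transitivity ((1 - rR x y) * (1 - rR y x) * mean (power_prob mu n)
    (fun t => \prod_(j < n) (fun z => (1 - rR x z) * (1 - rR y z)) (tnth t j))).
  rewrite -meanZl; last first.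
    apply: bmeas_prod => j; exact: (bmeas_tnth j (bmeasM (bt x) (bt y))).
  apply: eq_mean => t; rewrite /F2 !(tnth_tcons0, tnth_tconsS).
  by congr (_ * _); apply: eq_bigr => j _; rewrite !tnth_tconsS.
rewrite (mean_power_prod mu (h := fun (_ : 'I_n) z => (1 - rR x z) * (1 - rR y z))); last first.
  by move=> _; exact: bmeasM.
rewrite prodr_const card_ord; congr (_ * _ ^+ _).
have bxy : bmeas (fun z => rR x z * rR y z) by exact: bmeasM.
transitivity (mean mu (fun z => 1 - rR x z - rR y z + rR x z * rR y z)).
  by apply: eq_mean => z; rewrite mulrBr mulr1 mulrBl mul1r opprB addrA addrAC.
rewrite meanD//; last by apply: bmeasB.
by rewrite meanB// meanB// mean_cst.
Qed.

End maximal_events.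

Section exchangeability.
Context {d d' : measure_display} {T : measurableType d} {S : measurableType d'}
  {R : realType}.
Variables (P : probability T R) (X : nat -> {RV P >-> S}).

(** The computation for one point conditions on the head of the tuple, hence on [X 1]. Renaming the
    first two variables transfers its result, and measurability, to the event of [X 2]. *)
Definition swap12 (i : nat) : nat :=
  if i == 1%N then 2%N else if i == 2%N then 1%N else i.

Lemma swap12K : involutive swap12.
Proof. by case=> [|[|[|]]]. Qed.

Lemma swap12_le n i : (2 <= n)%N -> (1 <= i <= n)%N -> (1 <= swap12 i <= n)%N.
Proof. by case: i => [|[|[|i]]]//= n2 _; rewrite (ltn_trans _ n2). Qed.

Lemma mutually_independent_swap12 n : (2 <= n)%N ->
  mutually_independent P n X -> mutually_independent P n (X \o swap12).
Proof.
move=> n2 indep J A uJ sJ mA.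
have uJ' : uniq (map swap12 J) by rewrite map_inj_uniq//; exact: inv_inj swap12K.
have sJ' : {subset map swap12 J <= iota 1 n}.
  move=> _ /mapP[i /sJ iJ ->]; move: iJ.
  by rewrite !mem_iota !add1n !ltnS; exact: swap12_le.
have := indep _ (A \o swap12) uJ' sJ' (fun i => mA _).
rewrite big_map; under eq_bigr do rewrite /= swap12K; move=> <-; congr (P _).
apply/seteqP; split => w /= Aw i /=.
  by move=> /mapP[j jJ ->]; rewrite swap12K; exact: (Aw j).
by move=> iJ; have := Aw (swap12 i); rewrite /= swap12K; apply; exact: map_f.
Qed.

Lemma maximal_swap12 (r : S -> S -> bool) n : (2 <= n)%N ->
  maximal r (X \o swap12) n 1 = maximal r X n 2.
Proof.
move=> n2; apply/seteqP; split => w Aw j jn j1.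
  have := Aw (swap12 j); rewrite /= swap12K; apply; first exact: swap12_le.
  by apply: contra j1 => /eqP j1; rewrite -(swap12K j) j1.
apply: Aw; first exact: swap12_le.
by apply: contra j1 => /eqP j1; rewrite -(swap12K j) j1.
Qed.

End exchangeability.

(** * Moments on the unit cube *)

Section unit_interval.
Context {R : realType}.

Definition unif : probability (measurableTypeR R) R := uniform_prob (@ltr01 R).

(* Clipping [1 - x] to [[0, 1]] makes [mean_tailX] hold for every real [x], so
   that no argument has to be restricted to the cube. *)
Definition tail (x : R) : R := Num.max 0 (Num.min 1 (1 - x)).

Lemma tail_ge0 x : 0 <= tail x.
Proof. by rewrite /tail le_max lexx. Qed.

Lemma tail_le1 x : tail x <= 1.
Proof. by rewrite /tail ge_max ler01 ge_min lexx. Qed.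

Lemma tail_anti x y : x <= y -> tail y <= tail x.
Proof.
move=> xy; rewrite /tail ge_max !le_max lexx /=; apply/orP.
have [h|h] := leP (1 - y) 0; [left|right].
  by rewrite ge_min h orbT.
by rewrite le_min !ge_min lexx lerD2l lerN2 xy orbT.
Qed.

Lemma bmeas_le d (T : measurableType d) (f g : T -> R) :
  measurable_fun [set: T] f -> measurable_fun [set: T] g ->
  bmeas (fun t => (f t <= g t)%R%:R : R).
Proof.
move=> mf mg; split.
  rewrite (_ : (fun _ => _) = (fun t => if f t <= g t then 1 else 0)).
    by apply: measurable_fun_if => //; exact: measurable_fun_ler.
  by apply/funext => t; case: (f t <= g t)%R.
by exists 1 => t; case: (f t <= g t)%R; rewrite ?normr1 ?normr0 ?ler01.
Qed.

Lemma bmeas_tail d (T : measurableType d) (f : T -> R) :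
  measurable_fun [set: T] f -> bmeas (fun t => tail (f t)).
Proof.
move=> mf; split.
  apply: measurable_maxr => //; apply: measurable_minr => //.
  exact: measurable_funB.
by exists 1 => t; rewrite ger0_norm ?tail_le1 ?tail_ge0.
Qed.

Lemma integral_onemX (c : R) n : c < 1 ->
  (\int[lebesgue_measure]_(y in `[c, 1%R]) ((1 - y) ^+ n)%:E =
   ((1 - c) ^+ n.+1 / n.+1%:R)%:E)%E.
Proof.
move=> c1.
rewrite (@continuous_FTC2 _ _ (fun y => (1 - y) ^+ n.+1 / - n.+1%:R))//=.
- rewrite subrr expr0n/= mul0r -EFinB sub0r; congr EFin.
  by rewrite invrN mulrN opprK.
- apply: continuous_in_subspaceT => y _; exact: continuous_onemXn.
- split.
  + by move=> y _; apply: derivableM => //; exact: onemXn_derivable.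
  + apply: cvgM; last exact: cvg_cst.
    by apply: cvg_at_right_filter; exact: continuous_onemXn.
  + apply: cvgM; last exact: cvg_cst.
    by apply: cvg_at_left_filter; exact: continuous_onemXn.
- move=> y _; rewrite derive1Mr//; last exact: onemXn_derivable.
  by rewrite derive_onemXn mulrAC divff// mul1r.
Qed.

Lemma mean_tailX x n :
  mean unif (fun y => (x <= y)%R%:R * tail y ^+ n) = tail x ^+ n.+1 / n.+1%:R.
Proof.
have bf : bmeas (fun y : measurableTypeR R => (x <= y)%R%:R * tail y ^+ n).
  apply: bmeasM; first by apply: bmeas_le => //; exact: measurable_cst.
  by apply: bmeasX; exact: bmeas_tail.
apply: EFin_inj; rewrite EFin_mean// /unif integral_uniform; last 2 first.
- by apply/measurable_EFinP; case: bf.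
- by move=> y; rewrite lee_fin mulr_ge0// exprn_ge0// tail_ge0.
rewrite subr0 invr1 mul1e.
(* The law is carried by [[0, 1]], so the points above [x] form [[c, 1]] even for negative [x]. If
   [c >= 1] this interval is empty or a single point, and [tail x = 0] makes both sides vanish. *)
pose c := Num.max 0 x.
transitivity (\int[lebesgue_measure]_(y in `[c, 1%R]) ((1 - y) ^+ n)%:E)%E.
  rewrite [LHS]integral_mkcond [RHS]integral_mkcond; apply: eq_integral => y _.
  rewrite !patchE !mem_setE !in_itv /= /c ge_max -andbA.
  have [y0|y0] := leP 0 y => //=.
  have [y1|y1] := leP y 1; last by rewrite andbF.
  rewrite andbT; case: (x <= y); last by rewrite mul0r.
  rewrite mul1r /tail; do 2 f_equal; rewrite (min_idPr _) ?(max_idPr _)//.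
    by rewrite subr_ge0.
  by rewrite gerBl.
have [c1|c1] := ltP c 1.
  have x1 : x < 1 by move: c1; rewrite /c gt_max => /andP[].
  rewrite integral_onemX//; congr (_ ^+ _ / _)%:E; rewrite /tail /c.
  have [x0|x0] := leP 0 x.
    by rewrite (min_idPr _) ?gerBl// (max_idPr _)// subr_ge0 ltW.
  by rewrite subr0 (min_idPl _) ?(max_idPr _) ?ler01// lerDl oppr_ge0 ltW.
have -> : tail x = 0.
  rewrite /tail; apply/max_idPl; rewrite ge_min ler10 subr_le0.
  by move: c1; rewrite /c le_max ler10 orFb => ->.
rewrite expr0n /= mul0r; move: c1; rewrite le_eqVlt => /predU1P[<-|c1].
  by rewrite set_itv1 integral_set1.
by rewrite set_itv_ge ?integral_set0// bnd_simp -ltNge.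
Qed.

End unit_interval.

Section cube.
Context {R : realType}.
Implicit Type k : nat.

Local Notation cube k := (@uniform_cube R k).

Lemma mean_cube_cons k (f : k.+1.-tuple R -> R) : bmeas f ->
  mean (cube k.+1) f =
  mean unif (fun x => mean (cube k) (fun t => f (tuple_cons (x, t)))).
Proof.
move=> bf; rewrite mean_distribution// (mean_fubini _ _ (bmeas_comp _ bf))//.
Qed.

Lemma mean_cube0 (f : 0.-tuple R -> R) : mean (cube 0) f = f [tuple].
Proof.
transitivity (mean (cube 0) (fun=> f [tuple])); last exact: mean_cst.
by apply: eq_mean => t; rewrite (tuple0 t).
Qed.

Lemma tnth_tuple_cons0 k x (t : k.-tuple R) : tnth (tuple_cons (x, t)) ord0 = x.
Proof. exact: tnth0. Qed.

Lemma tnth_tuple_consS k x (t : k.-tuple R) i :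
  tnth (tuple_cons (x, t)) (lift ord0 i) = tnth t i.
Proof. exact: tnthS. Qed.

Lemma mean_cube_prod k (h : 'I_k -> R -> R) : (forall i, bmeas (h i)) ->
  mean (cube k) (fun t => \prod_(i < k) h i (tnth t i)) =
  \prod_(i < k) mean unif (h i).
Proof.
elim: k h => [|k IHk] h bh; first by rewrite mean_cube0 !big_ord0.
rewrite mean_cube_cons; last first.
  by apply: bmeas_prod => i; apply: bmeas_tnth.
rewrite big_ord_recl -IHk// -meanZr; last exact: bh.
apply: eq_mean => x.
under eq_mean do rewrite big_ord_recl tnth_tuple_cons0.
rewrite meanZl; last first.
  by apply: bmeas_prod => i; under eq_fun do rewrite tnth_tuple_consS; apply: bmeas_tnth.
congr (_ * _); apply: eq_mean => t.
by apply: eq_bigr => i _; rewrite tnth_tuple_consS.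
Qed.

Lemma bmeas_pair_tnth d (T : measurableType d) k (f : R * R -> R)
    (u v : T -> k.-tuple R) (i : 'I_k) : bmeas f ->
  measurable_fun [set: T] u -> measurable_fun [set: T] v ->
  bmeas (fun t => f (tnth (u t) i, tnth (v t) i)).
Proof.
move=> bf mu mv; apply: (bmeas_comp (h := fun t => (tnth (u t) i, tnth (v t) i))) bf.
by apply: measurable_fun_pair;
  apply: (measurableT_comp (f := fun x : k.-tuple R => tnth x i)) => //;
  exact: measurable_tnth.
Qed.

Lemma mean_cube2_prod k (f : R * R -> R) : bmeas f ->
  mean (cube k \x cube k)%E (fun z => \prod_(i < k) f (tnth z.1 i, tnth z.2 i)) =
  mean (unif \x unif)%E f ^+ k.
Proof.
move=> bf.
have bfk d (T : measurableType d) j (u v : T -> j.-tuple R) :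
    measurable_fun [set: T] u -> measurable_fun [set: T] v ->
    bmeas (fun t => \prod_(i < j) f (tnth (u t) i, tnth (v t) i)).
  by move=> mu mv; apply: bmeas_prod => i; exact: bmeas_pair_tnth.
rewrite mean_fubini; last exact: bfk.
elim: k => [|k IHk].
  by rewrite expr0 mean_cube0 mean_cube0 big_ord0.
(* [unif] lives on [measurableTypeR R]. The two measurable structures on pairs are convertible, but
   the type has to be given for Fubini to apply. *)
have bfu : bmeas (T := [the measurableType _ of (measurableTypeR R * measurableTypeR R)%type]) f.
  exact: bf.
have step (x : R) (t : k.-tuple R) :
  mean (cube k.+1) (fun y => \prod_(i < k.+1)
      f (tnth (tuple_cons (x, t), y).1 i, tnth (tuple_cons (x, t), y).2 i)) =
  mean unif (fun y => f (x, y)) *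
  mean (cube k) (fun s => \prod_(i < k) f (tnth t i, tnth s i)).
  rewrite mean_cube_cons; last first.
    have mc := @measurable_cst _ _ (k.+1.-tuple R) (k.+1.-tuple R) setT (tuple_cons (x, t)).
    exact: (bfk _ _ _ (fun=> tuple_cons (x, t)) idfun mc (@measurable_id _ _ _)).
  rewrite -meanZr; last exact: (bmeas_sectionl bfu).
  apply: eq_mean => y.
  rewrite -meanZl; last first.
    have mc := @measurable_cst _ _ (k.-tuple R) (k.-tuple R) setT t.
    exact: (bfk _ _ _ (fun=> t) idfun mc (@measurable_id _ _ _)).
  apply: eq_mean => s; rewrite big_ord_recl /= !tnth_tuple_cons0; congr (_ * _).
  by apply: eq_bigr => i _; rewrite !tnth_tuple_consS.
rewrite mean_cube_cons; last first.
  exact: (bmeas_meanl (cube k.+1) (cube k.+1) (bfk _ _ _ _ _ _ _)).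
rewrite exprS -IHk (mean_fubini _ _ bfu) -meanZr; last exact: (bmeas_meanl unif unif bfu).
apply: eq_mean => x.
rewrite -meanZl; last first.
  exact: (bmeas_meanl (cube k) (cube k) (bfk _ _ _ _ _ _ _)).
by apply: eq_mean => t; rewrite step.
Qed.

End cube.

Lemma mean_swap {d} {T : measurableType d} {R : realType}
    (P : probability T R) (f : T * T -> R) : bmeas f ->
  mean (P \x P)%E f = mean (P \x P)%E (fun z => f (z.2, z.1)).
Proof.
move=> bf.
have bg : bmeas (fun z => f (z.2, z.1)).
  by apply: (bmeas_comp (h := fun z : T * T => (z.2, z.1))) bf; exact: measurable_swap.
by rewrite (mean_fubini P P bf) (mean_fubini P P bg) (mean_exchange P P bf).
Qed.

Section moments.
Context {R : realType}.
Local Notation RR := [the measurableType _ of (measurableTypeR R * measurableTypeR R)%type].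

Lemma mean_tail n : mean (@unif R) (fun y => tail y ^+ n) = n.+1%:R^-1.
Proof.
have tail0 : tail (0 : R) = 1.
  by rewrite /tail subr0 (min_idPl _)// (max_idPr _).
have ble : bmeas (fun y : measurableTypeR R => (0 <= y)%R%:R : R).
  by apply: bmeas_le => //; exact: measurable_cst.
have btX : bmeas (fun y : measurableTypeR R => tail y ^+ n).
  by apply: bmeasX; exact: bmeas_tail.
have b1 : bmeas (fun y : measurableTypeR R => 1 : R) by exact: bmeas_cst.
have m1 : mean unif (fun y : R => (0 <= y)%R%:R : R) = 1.
  rewrite (eq_mean (T := measurableTypeR R) _ (g := fun y : R => (0 <= y)%R%:R * tail y ^+ 0)); last first.
    by move=> y; rewrite expr0 mulr1.
  by rewrite mean_tailX tail0 expr1n divr1.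
(* Split at [0]. The clipped [tail] is [1] on negative reals, which have mass zero: [m1] gives mass
   one to [y >= 0], and the integrand is at most [1]. *)
rewrite (eq_mean (T := measurableTypeR R) _ (g := fun y : R => (0 <= y)%R%:R * tail y ^+ n +
    (1 - (0 <= y)%R%:R) * tail y ^+ n)); last first.
  by move=> y; rewrite -mulrDl addrC subrK mul1r.
rewrite meanD; [|exact: bmeasM|by apply: bmeasM => //; exact: bmeasB].
rewrite mean_tailX tail0 expr1n mul1r.
suff -> : mean unif (fun y : R => (1 - (0 <= y)%R%:R) * tail y ^+ n) = 0.
  by rewrite addr0.
have n1 y : 0 <= 1 - (0 <= y :> R)%R%:R :> R.
  by case: (0 <= y)%R; rewrite ?subrr ?subr0 ?ler01.
apply/eqP; rewrite eq_le mean_ge0 ?andbT; last first.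
  by move=> y; exact: mulr_ge0 (n1 y) (exprn_ge0 _ (tail_ge0 y)).
rewrite -[leRHS](subrr 1) -[X in _ - X]m1 -[X in X - _](mean_cst unif) -meanB//.
apply: le_mean; [by apply: bmeasM => //; exact: bmeasB|exact: bmeasB|move=> y].
by rewrite ler_piMr// exprn_ile1 ?tail_ge0 ?tail_le1.
Qed.

(** The contribution of one coordinate to [volM], that is, to the monomial with exponents [a], [b],
    [c] in [vol z.1], [vol z.2] and [vol2 z.1 z.2]; see [volME]. *)
Definition tailM a b c (z : R * R) : R :=
  tail z.1 ^+ a * tail z.2 ^+ b * Num.min (tail z.1) (tail z.2) ^+ c.

Lemma tailM_ge0 a b c z : 0 <= tailM a b c z.
Proof. by rewrite !mulr_ge0// exprn_ge0// ?le_min ?tail_ge0. Qed.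

Lemma tailM_le1 a b c z : tailM a b c z <= 1.
Proof.
by rewrite !mulr_ile1 ?mulr_ge0 ?exprn_ge0 ?exprn_ile1//
  ?le_min ?ge_min ?tail_ge0 ?tail_le1.
Qed.

Lemma tailMC a b c x y : tailM a b c (x, y) = tailM b a c (y, x).
Proof. by rewrite /tailM/= minC [_ ^+ a * _]mulrC. Qed.

Lemma bmeas_le12 : bmeas (fun z : RR => (z.1 <= z.2)%R%:R : R).
Proof. by apply: bmeas_le; [exact: measurable_fst|exact: measurable_snd]. Qed.

Lemma bmeas_le21 : bmeas (fun z : RR => (z.2 <= z.1)%R%:R : R).
Proof. by apply: bmeas_le; [exact: measurable_snd|exact: measurable_fst]. Qed.

Lemma bmeas_tailM a b c : bmeas (T := RR) (tailM a b c).
Proof.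
have bt1 : bmeas (fun z : RR => tail z.1).
  by apply: bmeas_tail; exact: measurable_fst.
have bt2 : bmeas (fun z : RR => tail z.2).
  by apply: bmeas_tail; exact: measurable_snd.
apply: bmeasM; first by apply: bmeasM; exact: bmeasX.
apply: bmeasX; split.
  by apply: measurable_minr; [case: bt1|case: bt2].
by exists 1 => z; rewrite ger0_norm ?le_min ?ge_min ?tail_ge0 ?tail_le1.
Qed.

Let U2 := (@unif R \x @unif R)%E.

(** For [x <= y] the minimum of the tails is [tail y]. Integrating [tail y ^+ (b + c)] over [y >= x]
    produces the first denominator and raises the exponent of [tail x] to [a + b + c + 1], whose
    moment is the second. *)
Lemma mean_tailM12 a b c :
  mean U2 (fun z => (z.1 <= z.2)%R%:R * tailM a b c z) =
  ((b + c + 1)%:R * (a + b + c + 2)%:R)^-1.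
Proof.
rewrite mean_fubini; last exact: (bmeasM bmeas_le12 (bmeas_tailM a b c)).
transitivity (mean (@unif R) (fun x => (b + c + 1)%:R^-1 * tail x ^+ (a + b + c).+1)).
  apply: eq_mean => x /=.
  transitivity (mean (@unif R) (fun y => tail x ^+ a *
      ((x <= y)%R%:R * tail y ^+ (b + c)))).
    apply: eq_mean => y; rewrite /tailM /=.
    have [xy|xy] := leP x y; last by rewrite !(mul0r, mulr0).
    by rewrite (min_idPr (tail_anti xy)) !mul1r exprD mulrA.
  rewrite meanZl; last first.
    apply: bmeasM; first by apply: bmeas_le => //; exact: measurable_cst.
    by apply: bmeasX; exact: bmeas_tail.
  by rewrite mean_tailX mulrA -exprD [LHS]mulrC addn1 addnS addnA.
rewrite meanZl; last by apply: bmeasX; exact: bmeas_tail.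
by rewrite mean_tail -invfM addn2.
Qed.

Lemma mean_tailM21 a b c :
  mean U2 (fun z => (z.2 <= z.1)%R%:R * tailM a b c z) =
  ((a + c + 1)%:R * (a + b + c + 2)%:R)^-1.
Proof.
rewrite (mean_swap _ (bmeasM bmeas_le21 (bmeas_tailM a b c))).
transitivity (mean U2 (fun z => (z.1 <= z.2)%R%:R * tailM b a c z)).
  by apply: eq_mean => -[x y]; rewrite tailMC.
by rewrite mean_tailM12 [(b + a)%N]addnC.
Qed.

Let leDge (x y : R) : (x <= y)%R%:R + (y <= x)%R%:R - (x <= y)%R%:R * (y <= x)%R%:R = 1 :> R.
Proof.
by case: (ltgtP x y) => _; rewrite !(mulr1, mulr0, mul0r, addr0, add0r, subr0, addrK).
Qed.

(** Ties have probability zero: each of [x <= y] and [y <= x] has probability one half by the two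
    preceding lemmas, and by [leDge] their union is everything. *)
Lemma mean_tailM_diag a b c :
  mean U2 (fun z => (z.1 <= z.2)%R%:R * (z.2 <= z.1)%R%:R * tailM a b c z) = 0.
Proof.
have bp := bmeasM bmeas_le12 bmeas_le21.
have p_ge0 (z : R * R) : 0 <= (z.1 <= z.2)%R%:R * (z.2 <= z.1)%R%:R :> R.
  by rewrite mulr_ge0.
apply/eqP; rewrite eq_le mean_ge0 ?andbT; last first.
  by move=> z; rewrite mulr_ge0// tailM_ge0.
have m0 : mean U2 (fun z => (z.1 <= z.2)%R%:R * (z.2 <= z.1)%R%:R) = 0.
  have : mean U2 (fun=> 1) = 1 by rewrite mean_cst.
  rewrite -(eq_mean _ (fun z : RR => leDge z.1 z.2)).
  rewrite meanB; [|exact: (bmeasD bmeas_le12 bmeas_le21)|exact: bp].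
  rewrite (meanD _ bmeas_le12 bmeas_le21).
  have t0 z : tailM 0 0 0 z = 1 by rewrite /tailM !expr0 !mulr1.
  have -> : mean U2 (fun z => (z.1 <= z.2)%R%:R) = 2^-1.
    rewrite (eq_mean (T := RR) _ (g := fun z : R * R => (z.1 <= z.2)%R%:R * tailM 0 0 0 z)).
      by rewrite mean_tailM12 mul1r.
    by move=> z; rewrite t0 mulr1.
  have -> : mean U2 (fun z => (z.2 <= z.1)%R%:R) = 2^-1.
    rewrite (eq_mean (T := RR) _ (g := fun z : R * R => (z.2 <= z.1)%R%:R * tailM 0 0 0 z)).
      by rewrite mean_tailM21 mul1r.
    by move=> z; rewrite t0 mulr1.
  by move=> h; lra.
rewrite -[leRHS]m0; apply: le_mean; [|exact: bp|].
  exact: (bmeasM bp (bmeas_tailM a b c)).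
by move=> z; rewrite ler_piMr// tailM_le1.
Qed.

(** The numerator is [(a + c + 1) + (b + c + 1)]: the contributions of the two orders are added over
    a common denominator. *)
Lemma mean_tailM a b c :
  mean U2 (tailM a b c) =
  (a + b + 2 * c + 2)%:R / ((a + c + 1)%:R * (b + c + 1)%:R * (a + b + c + 2)%:R).
Proof.
have bM := bmeas_tailM a b c.
rewrite (eq_mean (T := RR) _ (g := fun z : R * R => (z.1 <= z.2)%R%:R * tailM a b c z +
    (z.2 <= z.1)%R%:R * tailM a b c z -
    (z.1 <= z.2)%R%:R * (z.2 <= z.1)%R%:R * tailM a b c z)); last first.
  by move=> z; rewrite -mulrDl -mulrBl leDge mul1r.
have bp := bmeasM bmeas_le12 bmeas_le21.
rewrite meanB; [|exact: (bmeasD (bmeasM bmeas_le12 bM) (bmeasM bmeas_le21 bM))|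
  exact: (bmeasM bp bM)].
rewrite (meanD _ (bmeasM bmeas_le12 bM) (bmeasM bmeas_le21 bM)).
rewrite mean_tailM12 mean_tailM21 mean_tailM_diag subr0.
have n0 n m : (n + m.+1)%:R != 0 :> R by rewrite pnatr_eq0 addnS.
have := (n0 (a + c) 0, n0 (b + c) 0, n0 (a + b + c) 1)%N.
rewrite !natrD => -[[h1 h2] h3].
by field; rewrite h1 h2 h3.
Qed.

End moments.

Section cube_moments.
Context {R : realType}.
Variable k : nat.
Implicit Types x y : k.-tuple R.

Local Notation cube := (@uniform_cube R k).

Definition precb x y : bool := [forall c, tnth x c <= tnth y c].

Lemma precP x y : reflect (prec x y) (precb x y).
Proof. exact: forallP. Qed.

Lemma precbE x y : (precb x y)%:R = \prod_(c < k) (tnth x c <= tnth y c)%R%:R :> R.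
Proof.
have [xy|/forallPn[c xyc]] := boolP (precb x y).
  by rewrite big1// => c _; have /forallP -> := xy.
by rewrite (bigD1 c)//= (negbTE xyc) mul0r.
Qed.

(* [vol] and [vol2] are the [U] and [W] of the introductory comment: see
   [mean_prec] and [mean_prec2]. *)
Definition vol x : R := \prod_(c < k) tail (tnth x c).

Definition vol2 x y : R :=
  \prod_(c < k) Num.min (tail (tnth x c)) (tail (tnth y c)).

Lemma mean_prec x : mean cube (fun z => (precb x z)%:R) = vol x.
Proof.
rewrite (eq_mean _ (precbE x)).
rewrite (mean_cube_prod (h := fun c u => (tnth x c <= u)%R%:R)); last first.
  by move=> c; apply: bmeas_le => //; exact: measurable_cst.
apply: eq_bigr => c _.
rewrite (eq_mean (T := measurableTypeR R) _ (g := fun u : R => (tnth x c <= u)%R%:R * tail u ^+ 0)).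
  by rewrite mean_tailX divr1.
by move=> u; rewrite expr0 mulr1.
Qed.

Lemma tail_max (u v : R) : tail (Num.max u v) = Num.min (tail u) (tail v).
Proof.
by have [uv|/ltW uv] := leP u v; have := tail_anti uv; case: leP => // h1 h2;
  apply/eqP; rewrite eq_le h2 ltW.
Qed.

Lemma mean_prec2 x y :
  mean cube (fun z => (precb x z)%:R * (precb y z)%:R) = vol2 x y.
Proof.
pose h (c : 'I_k) (u : R) : R := (Num.max (tnth x c) (tnth y c) <= u)%R%:R.
rewrite (eq_mean _ (g := fun z => \prod_(c < k) h c (tnth z c))); last first.
  move=> z; rewrite !precbE -big_split; apply: eq_bigr => c _ /=.
  by rewrite /h ge_max -mulnb natrM.
rewrite (mean_cube_prod (h := h)); last first.
  by move=> c; apply: bmeas_le => //; exact: measurable_cst.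
apply: eq_bigr => c _; rewrite -tail_max.
rewrite (eq_mean (T := measurableTypeR R) _ (g := fun u : R => (Num.max (tnth x c) (tnth y c) <= u)%R%:R * tail u ^+ 0)).
  by rewrite mean_tailX divr1.
by move=> u; rewrite expr0 mulr1.
Qed.

Lemma mean_volX n : mean cube (fun x => vol x ^+ n) = n.+1%:R^-1 ^+ k.
Proof.
rewrite (eq_mean _ (g := fun x => \prod_(c < k) tail (tnth x c) ^+ n)).
  rewrite (mean_cube_prod (h := fun (_ : 'I_k) u => tail u ^+ n)); last by move=> c; apply: bmeasX; exact: bmeas_tail.
  by rewrite mean_tail prodr_const card_ord.
by move=> x; rewrite -prodrXl.
Qed.

Let C2 := (cube \x cube)%E.

Definition volM a b c (z : k.-tuple R * k.-tuple R) : R :=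
  vol z.1 ^+ a * vol z.2 ^+ b * vol2 z.1 z.2 ^+ c.

Lemma volME a b c z :
  volM a b c z = \prod_(i < k) tailM a b c (tnth z.1 i, tnth z.2 i).
Proof. by rewrite /volM -!prodrXl -!big_split. Qed.

Section mean_volM.
Variables (a b c : nat).

Lemma mean_volM : mean C2 (volM a b c) =
  ((a + b + 2 * c + 2)%:R /
   ((a + c + 1)%:R * (b + c + 1)%:R * (a + b + c + 2)%:R)) ^+ k.
Proof.
by rewrite (eq_mean _ (volME a b c)) mean_cube2_prod ?mean_tailM//;
  exact: bmeas_tailM.
Qed.

Lemma mean_volM12 : mean C2 (fun z => (precb z.1 z.2)%:R * volM a b c z) =
  ((b + c + 1)%:R * (a + b + c + 2)%:R)^-1 ^+ k.
Proof.
rewrite -(mean_tailM12 a) -mean_cube2_prod; last first.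
  exact: (bmeasM bmeas_le12 (bmeas_tailM a b c)).
by apply: eq_mean => z; rewrite volME precbE -big_split.
Qed.

Lemma mean_volM21 : mean C2 (fun z => (precb z.2 z.1)%:R * volM a b c z) =
  ((a + c + 1)%:R * (a + b + c + 2)%:R)^-1 ^+ k.
Proof.
rewrite -(mean_tailM21 a) -mean_cube2_prod; last first.
  exact: (bmeasM bmeas_le21 (bmeas_tailM a b c)).
by apply: eq_mean => z; rewrite volME precbE -big_split.
Qed.

(** A power of the one-coordinate mean [0]. In dimension [0] all points coincide and the power would
    be [1]. *)
Lemma mean_volM_diag : (0 < k)%N ->
  mean C2 (fun z => (precb z.1 z.2)%:R * (precb z.2 z.1)%:R * volM a b c z) = 0.
Proof.
move=> k0; transitivity (0 ^+ k : R); last by rewrite expr0n eqn0Ngt k0.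
rewrite -(mean_tailM_diag a b c) -mean_cube2_prod; last first.
  exact: (bmeasM (bmeasM bmeas_le12 bmeas_le21) (bmeas_tailM a b c)).
by apply: eq_mean => z; rewrite volME !precbE -!big_split.
Qed.

Lemma bmeas_precb d (T : measurableType d) (u v : T -> k.-tuple R) :
  measurable_fun [set: T] u -> measurable_fun [set: T] v ->
  bmeas (fun t => (precb (u t) (v t))%:R : R).
Proof.
move=> mu mv; under eq_fun do rewrite precbE.
by apply: bmeas_prod => i; exact: (bmeas_pair_tnth _ bmeas_le12).
Qed.

Lemma bmeas_volM : bmeas (volM a b c).
Proof.
rewrite (_ : volM a b c = fun z => \prod_(i < k) tailM a b c (tnth z.1 i, tnth z.2 i)).
  apply: bmeas_prod => i; apply: (bmeas_pair_tnth _ (bmeas_tailM a b c)).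
    exact: measurable_fst.
  exact: measurable_snd.
exact/funext/volME.
Qed.

(** Over the common denominator the three terms of the numerator come from all pairs, from the pairs
    with [z.2] below [z.1], and from those with [z.1] below [z.2]. The pairs removed twice have mass
    zero. *)
Lemma mean_volM_incomparable : (0 < k)%N ->
  mean C2 (fun z => (1 - (precb z.1 z.2)%:R) * (1 - (precb z.2 z.1)%:R) *
    volM a b c z) =
  ((a + b + 2 * c + 2)%:R ^+ k - (b + c + 1)%:R ^+ k - (a + c + 1)%:R ^+ k) /
  ((a + c + 1)%:R ^+ k * (b + c + 1)%:R ^+ k * (a + b + c + 2)%:R ^+ k).
Proof.
move=> k0.
have b12 : bmeas (fun z : k.-tuple R * k.-tuple R => (precb z.1 z.2)%:R : R).
  by apply: bmeas_precb; [exact: measurable_fst|exact: measurable_snd].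
have b21 : bmeas (fun z : k.-tuple R * k.-tuple R => (precb z.2 z.1)%:R : R).
  by apply: bmeas_precb; [exact: measurable_snd|exact: measurable_fst].
have bM := bmeas_volM.
rewrite (eq_mean _ (g := fun z => volM a b c z - (precb z.1 z.2)%:R * volM a b c z
  - (precb z.2 z.1)%:R * volM a b c z
  + (precb z.1 z.2)%:R * (precb z.2 z.1)%:R * volM a b c z)); last first.
  by move=> z; ring.
have := (bmeasM b12 bM, bmeasM b21 bM, bmeasM (bmeasM b12 b21) bM).
move=> -[[bM12 bM21] bMd].
rewrite meanD//; last by apply: bmeasB => //; exact: bmeasB.
rewrite meanB//; last exact: bmeasB.
rewrite meanB// mean_volM mean_volM12 mean_volM21 mean_volM_diag// addr0.
have n0 n m : (n + m.+1)%:R ^+ k != 0 :> R by rewrite expf_neq0// pnatr_eq0 addnS.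
rewrite expr_div_n !exprVn !exprMn.
move: (n0 (a + c) 0) (n0 (b + c) 0) (n0 (a + b + c) 1)%N.
set A := _ ^+ k; set B := _ ^+ k; set C := _ ^+ k => hA hB hC.
by field; rewrite hA hB hC.
Qed.

End mean_volM.

End cube_moments.

(** * Power inequalities and multinomial expansion *)

Section multinomial.
Context {R : numFieldType}.
Implicit Types (x y z w : R) (F : nat -> R).

Let sum_conv N m a F : (m < N)%N ->
  \sum_(i < N | (a + i == m)%N) F i = if (a <= m)%N then F (m - a)%N else 0.
Proof.
move=> mN; case: leqP => [am|ma]; last first.
  by rewrite big_pred0// => i; apply/eqP => aim; move: ma; rewrite -aim ltnNge leq_addr.
have lt : (m - a < N)%N by rewrite (leq_ltn_trans (leq_subr _ _)).
rewrite (big_pred1 (Ordinal lt))// => i /=.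
by rewrite -val_eqE /= -[RHS](eqn_add2l a) subnKC.
Qed.

Let sum_conv_conv N m a b F : (m < N)%N ->
  \sum_(j < N | (a + j == m)%N) \sum_(i < N | (b + i == j)%N) F i =
  \sum_(i < N | (a + b + i == m)%N) F i.
Proof.
move=> mN; rewrite (sum_conv a (fun j => \sum_(i < N | (b + i == j)%N) F i))//.
rewrite (sum_conv (a + b) F)//; case: leqP => am; last first.
  by case: leqP => // abm; move: am; rewrite ltnNge (leq_trans (leq_addr b a)).
rewrite (sum_conv b F) ?(leq_ltn_trans (leq_subr _ _))//.
by rewrite leq_subRL// subnDA.
Qed.

(** Divided powers: for them the binomial theorem is a convolution without coefficients. Three
    convolutions then give four variables, with [m!] over the four factorials as the only
    coefficient. *)
Let dpow x n : R := x ^+ n / n`!%:R.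

Let dpowD x y m N : (m < N)%N ->
  dpow (x + y) m = \sum_(a < N) \sum_(b < N | (a + b == m)%N) dpow x a * dpow y b.
Proof.
move=> mN.
under eq_bigr => a _ do rewrite (sum_conv a (fun b => dpow x a * dpow y b))//.
rewrite -big_mkcond /= -(big_ord_widen _ (fun a => dpow x a * dpow y (m - a)) mN).
rewrite {1}/dpow addrC exprDn mulr_suml; apply: eq_bigr => -[i /= im] _.
rewrite /dpow -(@bin_fact m i im) -mulr_natr natrM natrM.
have f0 n : n`!%:R != 0 :> R by rewrite pnatr_eq0 -lt0n fact_gt0.
have c0 : 'C(m, i)%:R != 0 :> R by rewrite pnatr_eq0 -lt0n bin_gt0.
by field; rewrite !f0 c0.
Qed.

Lemma exprD4n x y z w m :
  (x + (y + (z + w))) ^+ m =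
  \sum_(a < m.+1) \sum_(b < m.+1) \sum_(c < m.+1)
    \sum_(f < m.+1 | (a + b + c + f == m)%N)
      m`!%:R / (a`! * b`! * c`! * f`!)%:R * (x ^+ a * y ^+ b * z ^+ c * w ^+ f).
Proof.
have mN := ltnSn m.
have f0 n : n`!%:R != 0 :> R by rewrite pnatr_eq0 -lt0n fact_gt0.
have -> : (x + (y + (z + w))) ^+ m = m`!%:R * dpow (x + (y + (z + w))) m.
  by rewrite /dpow mulrC divfK.
rewrite (dpowD _ _ mN) big_distrr /=; apply: eq_bigr => a _.
transitivity (m`!%:R * \sum_(b < m.+1) \sum_(c < m.+1)
    \sum_(f < m.+1 | (a + b + c + f == m)%N)
      dpow x a * (dpow y b * (dpow z c * dpow w f))).
  congr (_ * _).
  transitivity (\sum_(j < m.+1 | (a + j == m)%N) \sum_(b < m.+1)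
      \sum_(i < m.+1 | (b + i == j)%N) dpow x a * (dpow y b * dpow (z + w) i)).
    apply: eq_bigr => j _; rewrite (dpowD _ _ (ltn_ord j)) big_distrr /=.
    by apply: eq_bigr => b _; rewrite big_distrr.
  rewrite exchange_big /=; apply: eq_bigr => b _.
  rewrite (sum_conv_conv a b (fun i => dpow x a * (dpow y b * dpow (z + w) i)))//.
  transitivity (\sum_(i < m.+1 | (a + b + i == m)%N) \sum_(c < m.+1)
      \sum_(f < m.+1 | (c + f == i)%N)
         dpow x a * (dpow y b * (dpow z c * dpow w f))).
    apply: eq_bigr => i _; rewrite (dpowD _ _ (ltn_ord i)) !big_distrr /=.
    by apply: eq_bigr => c _; rewrite !big_distrr.
  rewrite exchange_big /=; apply: eq_bigr => c _.
  by rewrite (sum_conv_conv (a + b) c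
    (fun f => dpow x a * (dpow y b * (dpow z c * dpow w f)))).
do 3 (rewrite big_distrr /=; apply: eq_bigr => ? _).
by rewrite /dpow !natrM; field; rewrite !f0.
Qed.

End multinomial.

(** With [subrX_ge], a discrete mean value inequality: after factoring out [x - y], each of the
    remaining terms [x^(m-1-i) y^i] lies between [y^(m-1)] and [x^(m-1)]. It serves both for
    survival powers and for powers of logarithms. *)
Lemma subrX_le {R : realDomainType} (x y : R) m : 0 <= y -> y <= x ->
  x ^+ m - y ^+ m <= m%:R * (x - y) * x ^+ m.-1.
Proof.
move=> y0 yx; have x0 := le_trans y0 yx.
case: m => [|m]; first by rewrite subrr !mul0r.
rewrite subrXX -mulrA mulrCA ler_wpM2l ?subr_ge0//=.
rewrite mulr_natl -[m.+1 in leRHS](card_ord m.+1) -sumr_const.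
apply: ler_sum => -[i im] _ /=.
have -> : x ^+ m = x ^+ (m - i) * x ^+ i by rewrite -exprD subnK.
by rewrite ler_wpM2l ?exprn_ge0// lerXn2r.
Qed.

Lemma subrX_ge {R : realDomainType} (x y : R) m : 0 <= y -> y <= x ->
  m.+1%:R * (x - y) * y ^+ m <= x ^+ m.+1 - y ^+ m.+1.
Proof.
move=> y0 yx; have x0 := le_trans y0 yx.
rewrite subrXX -mulrA mulrCA ler_wpM2l ?subr_ge0//=.
rewrite mulr_natl -[m.+1 in leLHS](card_ord m.+1) -sumr_const.
apply: ler_sum => -[i im] _ /=.
have -> : y ^+ m = y ^+ (m - i) * y ^+ i by rewrite -exprD subnK.
by rewrite ler_wpM2r ?exprn_ge0// lerXn2r.
Qed.

(** * Integrals of powers of the uncovered volume *)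

Section nondominated.
Context {R : realType}.
Implicit Type k : nat.

Local Notation cube k := (@uniform_cube R k).

Lemma prod_ge0_le1 (I : Type) (s : seq I) (F : I -> R) :
  (forall i, 0 <= F i <= 1) -> 0 <= \prod_(i <- s) F i <= 1.
Proof.
move=> F01; rewrite prodr_ge0 ?prodr_ile1// => i _; by have /andP[] := F01 i.
Qed.

Lemma vol01 k (x : k.-tuple R) : 0 <= vol x <= 1.
Proof. by apply: prod_ge0_le1 => i; rewrite tail_ge0 tail_le1. Qed.

Lemma onem_vol01 k (x : k.-tuple R) : 0 <= 1 - vol x <= 1.
Proof. by have /andP[v0 v1] := vol01 x; rewrite subr_ge0 v1 gerBl. Qed.

Lemma bmeas_vol d (T : measurableType d) k (u : T -> k.-tuple R) :
  measurable_fun [set: T] u -> bmeas (fun t => vol (u t)).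
Proof.
move=> mu; apply: bmeas_prod => i; apply: bmeas_tail.
apply: (measurableT_comp (f := fun x : k.-tuple R => tnth x i)) => //.
exact: measurable_tnth.
Qed.

Lemma bmeas_onem_volX d (T : measurableType d) k (u : T -> k.-tuple R) s n :
  measurable_fun [set: T] u -> bmeas (fun t => (1 - s * vol (u t)) ^+ n).
Proof.
move=> mu; apply: bmeasX; apply: bmeasB; first exact: bmeas_cst.
by apply: bmeasM; [exact: bmeas_cst|exact: bmeas_vol].
Qed.

(** For [s = 1] this is [p_(m+1)] in dimension [k]. Other values of [s] occur when one coordinate of
    a point is fixed: its tail then multiplies the volume in the remaining coordinates. *)
Definition survive k m (s : R) : R :=
  mean (cube k) (fun x => (1 - s * vol x) ^+ m).

Lemma surviveE k m s :
  survive k m s = \sum_(i < m.+1) ((- s) ^+ i *+ 'C(m, i)) * i.+1%:R^-1 ^+ k.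
Proof.
rewrite /survive (eq_mean _ (g := fun x =>
    \sum_(i < m.+1) ((- s) ^+ i *+ 'C(m, i)) * vol x ^+ i)); last first.
  move=> x; rewrite -mulNr exprDn; apply: eq_bigr => i _.
  by rewrite expr1n mul1r exprMn mulrnAl.
have bv (i : nat) : bmeas (fun x : k.-tuple R => vol x ^+ i).
  by apply: bmeasX; apply: bmeas_vol; exact: measurable_id.
rewrite mean_sum => [|i]; last by apply: bmeasM => //; exact: bmeas_cst.
by apply: eq_bigr => i _; rewrite meanZl// mean_volX.
Qed.

Lemma survive0 m s : survive 0 m s = (1 - s) ^+ m.
Proof. by rewrite /survive mean_cube0 /vol big_ord0 mulr1. Qed.

(** Compare coefficients of the powers of [- s] in [surviveE]. The identity [C] splits [(m + 2)]
    times the binomial coefficient, and its term with factor [i + 1] cancels one factor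
    [1 / (i + 1)], lowering the dimension by one. *)
Lemma surviveS k m s :
  m.+2%:R * survive k.+1 m.+1 s = m.+1%:R * survive k.+1 m s + survive k m.+1 s.
Proof.
rewrite !surviveE !big_distrr /=.
rewrite [X in _ = X + _](_ : _ = \sum_(i < m.+2)
    m.+1%:R * ((- s) ^+ i *+ 'C(m, i) * i.+1%:R^-1 ^+ k.+1)); last first.
  by rewrite [RHS]big_ord_recr /= bin_small// mulr0n mul0r mulr0 addr0.
rewrite -big_split /=; apply: eq_bigr => -[i /= im] _.
have C : (m.+2 * 'C(m.+1, i) = m.+1 * 'C(m, i) + i.+1 * 'C(m.+1, i))%N.
  by rewrite (mul_bin_down m.+1) -mulnDl addnS subnK.
have {}C : m.+2%:R * 'C(m.+1, i)%:R =
    m.+1%:R * 'C(m, i)%:R + i.+1%:R * 'C(m.+1, i)%:R :> R.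
  by rewrite -!natrM C natrD.
rewrite -[_ *+ 'C(m.+1, i)]mulr_natr -[_ *+ 'C(m, i)]mulr_natr exprS.
have i0 : i.+1%:R != 0 :> R by rewrite pnatr_eq0.
set E := (- s) ^+ i; set V := _ ^+ k.
transitivity (m.+2%:R * 'C(m.+1, i)%:R * (E * V / i.+1%:R)); first by ring.
by rewrite C; field.
Qed.

(** Obtained by telescoping [surviveS]. For [s = 1] it counts maxima after ranking [m + 1] points by
    one coordinate: the point with [j] others above it there is maximal exactly when, in the other
    [k] coordinates, it is maximal among these [j + 1] points. *)
Lemma sum_survive k m s :
  m.+1%:R * survive k.+1 m s = \sum_(j < m.+1) survive k j s.
Proof.
elim: m => [|m IHm]; last by rewrite surviveS IHm [RHS]big_ord_recr.
by rewrite big_ord1 mul1r /survive; rewrite !(eq_mean _ (fun x => expr0 _)) !mean_cst.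
Qed.

Lemma survive_ge0 k m s : 0 <= s <= 1 -> 0 <= survive k m s.
Proof.
move=> /andP[s0 s1]; apply: mean_ge0 => x; apply: exprn_ge0.
by have /andP[v0 v1] := vol01 x; rewrite subr_ge0 mulr_ile1.
Qed.

(** Removes the parameter [s] at the price of one factor [s], which [mean_half] has available. By
    [sum_survive] the inequality passes from each dimension to the next. The induction starts in
    dimension one, where it reads [1 - (1 - s)^(m+1) <= 1]; in dimension zero it fails. *)
Lemma mul_survive_le k m s : 0 <= s <= 1 ->
  s * survive k.+1 m s <= survive k.+1 m 1.
Proof.
move=> /andP[s0 s1]; elim: k m => [|k IHk] m;
  rewrite -(ler_pM2l (ltr0Sn R m)) mulrCA !sum_survive big_distrr /=.
  under eq_bigr do rewrite survive0.
  under [leRHS]eq_bigr do rewrite survive0 subrr.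
  rewrite [leRHS](_ : _ = 1); last first.
    by rewrite big_ord_recl big1 ?addr0// => i _; rewrite expr0n.
  have := subrXX 1 (1 - s) m.+1; rewrite expr1n subKr => h.
  rewrite -big_distrr /=.
  rewrite [leLHS](_ : _ = 1 - (1 - s) ^+ m.+1).
    by rewrite gerBl exprn_ge0// subr_ge0.
  by rewrite h; congr (_ * _); apply: eq_bigr => i _; rewrite expr1n mul1r.
by apply: ler_sum => i _; exact: IHk.
Qed.

Lemma mean_vol_survive k m :
  mean (cube k) (fun x => (1 - vol x) ^+ m * vol x) =
  survive k m 1 - survive k m.+1 1.
Proof.
rewrite /survive -meanB; try exact: bmeas_onem_volX.
by apply: eq_mean => x; rewrite mul1r exprS; ring.
Qed.

End nondominated.

Lemma mean_pair_mul {d1 d2} {T1 : measurableType d1} {T2 : measurableType d2}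
    {R : realType} (P1 : probability T1 R) (P2 : probability T2 R)
    (f : T1 -> R) (g : T2 -> R) : bmeas f -> bmeas g ->
  mean (P1 \x P2)%E (fun z => f z.1 * g z.2) = mean P1 f * mean P2 g.
Proof.
move=> bf bg; rewrite mean_fubini; last first.
  by apply: bmeasM; [exact: bmeas_fst|exact: bmeas_snd].
by rewrite -meanZr//; apply: eq_mean => x /=; rewrite meanZl.
Qed.

(** * Pairs of maxima: lower bound *)

Section pair_bounds.
Context {R : realType}.
Implicit Type k : nat.

Local Notation cube k := (@uniform_cube R k).
Local Notation cube2 k := (cube k \x cube k)%E.

Lemma vol2C k (x y : k.-tuple R) : vol2 x y = vol2 y x.
Proof. by apply: eq_bigr => i _; rewrite minC. Qed.

Lemma vol2_lel k (x y : k.-tuple R) : vol2 x y <= vol x.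
Proof.
by apply: ler_prod => i _; rewrite le_min !tail_ge0 ge_min lexx.
Qed.

Lemma vol2_ler k (x y : k.-tuple R) : vol2 x y <= vol y.
Proof. by rewrite vol2C vol2_lel. Qed.

Lemma vol2_ge_mul k (x y : k.-tuple R) : vol x * vol y <= vol2 x y.
Proof.
rewrite -big_split; apply: ler_prod => i _ /=.
rewrite mulr_ge0 ?tail_ge0//= le_min.
by rewrite ler_piMr ?ler_piMl ?tail_ge0 ?tail_le1.
Qed.

Lemma onem_mul_le k (x y : k.-tuple R) :
  (1 - vol x) * (1 - vol y) <= 1 - vol x - vol y + vol2 x y.
Proof. by have := vol2_ge_mul x y; lra. Qed.

Lemma bmeas_vol2 k : bmeas (fun z : k.-tuple R * k.-tuple R => vol2 z.1 z.2).
Proof.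
rewrite (_ : (fun _ => _) = volM 0 0 1); first exact: bmeas_volM.
by apply/funext => z; rewrite /volM !expr0 !mul1r.
Qed.

Lemma bmeas_fst_survive k m :
  bmeas (fun z : k.-tuple R * k.-tuple R => (1 - vol z.1) ^+ m).
Proof.
apply: bmeasX; apply: bmeasB; first exact: bmeas_cst.
by apply: bmeas_vol; exact: measurable_fst.
Qed.

Lemma bmeas_snd_survive k m :
  bmeas (fun z : k.-tuple R * k.-tuple R => (1 - vol z.2) ^+ m).
Proof.
apply: bmeasX; apply: bmeasB; first exact: bmeas_cst.
by apply: bmeas_vol; exact: measurable_snd.
Qed.

Lemma bmeas_prec12 k :
  bmeas (fun z : k.-tuple R * k.-tuple R => (precb z.1 z.2)%:R : R).
Proof. by apply: bmeas_precb; [exact: measurable_fst|exact: measurable_snd]. Qed.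

Lemma bmeas_prec21 k :
  bmeas (fun z : k.-tuple R * k.-tuple R => (precb z.2 z.1)%:R : R).
Proof. by apply: bmeas_precb; [exact: measurable_snd|exact: measurable_fst]. Qed.

Definition incomp k (z : k.-tuple R * k.-tuple R) : R :=
  (1 - (precb z.1 z.2)%:R) * (1 - (precb z.2 z.1)%:R).

Lemma bmeas_incomp k : bmeas (@incomp k).
Proof.
apply: bmeasM; apply: bmeasB; try exact: bmeas_cst.
  exact: bmeas_prec12.
exact: bmeas_prec21.
Qed.

Lemma incomp01 k (z : k.-tuple R * k.-tuple R) : 0 <= incomp z <= 1.
Proof.
rewrite /incomp; case: (precb _ _); case: (precb _ _);
  by rewrite ?(subrr, subr0, mul0r, mulr0, mulr1, lexx, ler01).
Qed.

(** This is [e_(m+2)]: the exponent counts the points other than the chosen two. *)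
Definition pair_survive k m : R :=
  mean (cube2 k) (fun z => incomp z * (1 - vol z.1 - vol z.2 + vol2 z.1 z.2) ^+ m).

Lemma bmeas_pair_survive k m : bmeas (fun z : k.-tuple R * k.-tuple R =>
  (1 - vol z.1 - vol z.2 + vol2 z.1 z.2) ^+ m).
Proof.
apply: bmeasX; apply: bmeasD; last exact: bmeas_vol2.
apply: bmeasB; last by apply: bmeas_vol; exact: measurable_snd.
apply: bmeasB; first exact: bmeas_cst.
by apply: bmeas_vol; exact: measurable_fst.
Qed.

Lemma survive1E k m : survive k m 1 = mean (cube k) (fun x => (1 - vol x) ^+ m).
Proof. by apply: eq_mean => x; rewrite mul1r. Qed.

Let bS k m : bmeas (fun x : k.-tuple R => (1 - vol x) ^+ m).
Proof.
apply: bmeasX; apply: bmeasB; first exact: bmeas_cst.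
by apply: bmeas_vol; exact: measurable_id.
Qed.

Lemma mean_survive2 k m :
  mean (cube2 k) (fun z => (1 - vol z.1) ^+ m * (1 - vol z.2) ^+ m) =
  survive k m 1 ^+ 2.
Proof. by rewrite (mean_pair_mul _ _ (bS _ _) (bS _ _)) expr2 survive1E. Qed.

Lemma mean_prec_survive k m :
  mean (cube2 k) (fun z => (precb z.1 z.2)%:R * (1 - vol z.1) ^+ m) =
  survive k m 1 - survive k m.+1 1.
Proof.
rewrite mean_fubini; last first.
  by apply: bmeasM; [exact: bmeas_prec12|exact: bmeas_fst_survive].
rewrite -mean_vol_survive; apply: eq_mean => x /=.
rewrite meanZr ?mean_prec 1?mulrC//.
exact: (bmeas_sectionl (@bmeas_prec12 k)).
Qed.

(** The power is at least the product [U * V] of the proof. On comparable pairs this product is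
    given up, and it is at most the factor of the lower point alone; integrating out the upper point
    then gives a difference of consecutive [survive] values. The exponent [m] belongs to [p_(n-1)]
    with [n = m + 2], not to [p_n]. *)
Lemma pair_survive_ge k m :
  survive k m 1 ^+ 2 - 2 * (survive k m 1 - survive k m.+1 1) <=
  pair_survive k m.
Proof.
have b12 := bmeasM (@bmeas_prec12 k) (@bmeas_fst_survive k m).
have b21 := bmeasM (@bmeas_prec21 k) (@bmeas_snd_survive k m).
have bq := bmeasM (@bmeas_fst_survive k m) (@bmeas_snd_survive k m).
have m12 := mean_prec_survive k m.
have m21 : mean (cube2 k) (fun z => (precb z.2 z.1)%:R * (1 - vol z.2) ^+ m) =
    survive k m 1 - survive k m.+1 1.
  by rewrite (mean_swap _ b21) -m12; apply: eq_mean => -[].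
rewrite -mean_survive2 -[2]/(1 + 1) mulrDl mul1r opprD addrA -{1}m12 -m21.
rewrite -meanB// -meanB//; last exact: bmeasB.
apply: le_mean.
- by apply: bmeasB => //; exact: bmeasB.
- by apply: bmeasM; [exact: bmeas_incomp|exact: bmeas_pair_survive].
move=> z.
have /andP[u0 u1] := onem_vol01 z.1; have /andP[v0 v1] := onem_vol01 z.2.
set U := (1 - vol z.1) ^+ m; set V := (1 - vol z.2) ^+ m.
have UV : U * V <= (1 - vol z.1 - vol z.2 + vol2 z.1 z.2) ^+ m.
  rewrite -exprMn lerXn2r ?nnegrE ?mulr_ge0//; last exact: onem_mul_le.
  by rewrite (le_trans _ (onem_mul_le _ _))// mulr_ge0.
have /andP[i0 i1] := incomp01 z.
apply: le_trans (ler_wpM2l i0 UV).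
have U0 : 0 <= U by rewrite exprn_ge0.
have V0 : 0 <= V by rewrite exprn_ge0.
have UV0 := mulr_ge0 U0 V0.
have UVU : U * V <= U by rewrite ler_piMr// exprn_ile1.
have UVV : U * V <= V by rewrite ler_piMl// exprn_ile1.
rewrite /incomp; case: (precb _ _); case: (precb _ _);
  rewrite ?(subrr, subr0, mul0r, mulr0, mul1r) //; lra.
Qed.

End pair_bounds.

(** * Pairs of maxima: upper bound *)

Section pair_upper.
Context {R : realType}.
Variable k : nat.

Local Notation cube k := (@uniform_cube R k).
Local Notation cube2 k := (cube k \x cube k)%E.
Local Notation cubeT := (k.+2.-tuple R).

Let rest (x : cubeT) : R := \prod_(i < k.+1) tail (tnth x (lift ord0 i)).

Let rest_ge0 x : 0 <= rest x.
Proof. by apply: prodr_ge0 => i _; rewrite tail_ge0. Qed.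

Let half (z : cubeT * cubeT) : R :=
  (tnth z.1 ord0 <= tnth z.2 ord0)%R%:R * tail (tnth z.2 ord0) * rest z.1.

Let bmeas_half : bmeas half.
Proof.
apply: bmeasM; first apply: bmeasM.
- apply: (bmeas_pair_tnth (u := fst) (v := snd) ord0 bmeas_le12).
    exact: measurable_fst.
  exact: measurable_snd.
- apply: bmeas_tail.
  exact: (proj1 (measurable_fun_tnthP _) measurable_snd ord0).
- apply: bmeas_prod => i; apply: bmeas_tail.
  exact: (proj1 (measurable_fun_tnthP _) measurable_fst (lift ord0 i)).
Qed.

(* Depending on which of the two points has the larger first coordinate, the
   first factor of [vol2] is taken from it and the other factors from the other
   point. *)
Let vol2_le_half (x y : cubeT) : vol2 x y <= half (x, y) + half (y, x).
Proof.
have aux (x' y' : cubeT) : tnth x' ord0 <= tnth y' ord0 -> vol2 x' y' <= half (x', y').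
  move=> xy; rewrite /half /= xy mul1r /vol2 big_ord_recl.
  apply: ler_pM.
  - by rewrite le_min !tail_ge0.
  - by apply: prodr_ge0 => i _; rewrite le_min !tail_ge0.
  - by rewrite ge_min lexx orbT.
  - by apply: ler_prod => i _; rewrite le_min !tail_ge0 ge_min lexx.
have half_ge0 z : 0 <= half z.
  by rewrite mulr_ge0 ?rest_ge0// mulr_ge0 ?tail_ge0.
have [xy|/ltW yx] := leP (tnth x ord0) (tnth y ord0).
  by rewrite (le_trans (aux _ _ xy))// lerDl.
by rewrite vol2C (le_trans (aux _ _ yx))// lerDr.
Qed.

(** Fix [x] and write [y] as a first coordinate and a rest [t]. By [mul_survive_le] with [s] the
    tail of this coordinate, the integral over [t] is at most [survive k.+1 h 1]. Integrating the
    coordinate over values at least that of [x] gives back the first factor of [vol x], so [rest x]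
    is completed to [vol x] before [x] is integrated. *)
Let mean_half h :
  mean (cube2 k.+2) (fun z => half z * ((1 - vol z.1) ^+ h * (1 - vol z.2) ^+ h)) <=
  survive k.+1 h 1 * (survive k.+2 h 1 - survive k.+2 h.+1 1).
Proof.
have bS j m : bmeas (fun x : j.-tuple R => (1 - vol x) ^+ m).
  apply: bmeasX; apply: bmeasB; first exact: bmeas_cst.
  by apply: bmeas_vol; exact: measurable_id.
have bv : bmeas (fun x : cubeT => vol x) by apply: bmeas_vol; exact: measurable_id.
have bM := bmeasM bmeas_half
  (bmeasM (@bmeas_fst_survive _ k.+2 h) (@bmeas_snd_survive _ k.+2 h)).
rewrite mean_fubini// -mean_vol_survive -meanZl; last exact: (bmeasM (bS _ _) bv).
apply: le_mean.
- exact: (bmeas_meanl (cube k.+2) (cube k.+2) bM).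
- by apply: bmeasM; [exact: bmeas_cst|exact: (bmeasM (bS _ _) bv)].
move=> x /=.
have /andP[x0 x1] := onem_vol01 x.
pose f (y : cubeT) := (tnth x ord0 <= tnth y ord0)%R%:R *
  (tail (tnth y ord0) * (1 - vol y) ^+ h).
have bf : bmeas f.
  apply: bmeasM.
    apply: bmeas_le; first exact: measurable_cst.
    exact: measurable_tnth.
  apply: bmeasM; last exact: bS.
  by apply: bmeas_tail; exact: measurable_tnth.
rewrite (eq_mean _ (g := fun y => rest x * (1 - vol x) ^+ h * f y)); last first.
  by move=> y; rewrite /half /f /=; ring.
rewrite meanZl//.
have volx : vol x = tail (tnth x ord0) * rest x by rewrite /vol big_ord_recl.
rewrite volx -volx [leRHS](_ : _ = rest x * (1 - vol x) ^+ h *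
    (tail (tnth x ord0) * survive k.+1 h 1)); last by rewrite volx; ring.
rewrite ler_wpM2l ?mulr_ge0 ?rest_ge0 ?exprn_ge0//.
rewrite mean_cube_cons//.
have bg : bmeas (fun y : measurableTypeR R =>
    (tnth x ord0 <= y)%R%:R * tail y ^+ 0 * survive k.+1 h 1).
  apply: bmeasM; last exact: bmeas_cst.
  apply: bmeasM; last by apply: bmeasX; exact: bmeas_tail.
  by apply: bmeas_le => //; exact: measurable_cst.
apply: (@le_trans _ _ (mean (@unif R) (fun y : R =>
    (tnth x ord0 <= y)%R%:R * tail y ^+ 0 * survive k.+1 h 1))); last first.
  rewrite meanZr ?mean_tailX ?divr1 ?expr1//.
  apply: bmeasM; last by apply: bmeasX; exact: bmeas_tail.
  by apply: bmeas_le => //; exact: measurable_cst.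
apply: le_mean => //.
  have bfc : bmeas (fun z : measurableTypeR R * k.+1.-tuple R => f (tuple_cons z)).
    exact: bmeas_comp bf.
  exact: (bmeas_meanl unif (cube k.+1) bfc).
move=> y; rewrite expr0 mulr1.
have bs : bmeas (fun t : k.+1.-tuple R => (1 - tail y * vol t) ^+ h).
  by apply: bmeas_onem_volX; exact: measurable_id.
rewrite (eq_mean _ (g := fun t => (tnth x ord0 <= y)%R%:R *
    (tail y * (1 - tail y * vol t) ^+ h))); last first.
  move=> t; rewrite /f tnth_tuple_cons0 [vol (tuple_cons _)]big_ord_recl.
  rewrite tnth_tuple_cons0; do 5 f_equal.
  by congr (_ * _); apply: eq_bigr => i _; rewrite tnth_tuple_consS.
rewrite meanZl; last by apply: bmeasM => //; exact: bmeas_cst.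
rewrite ler_wpM2l// meanZl//.
by apply: mul_survive_le; rewrite tail_ge0 tail_le1.
Qed.

Lemma mean_vol2_survive h :
  mean (cube2 k.+2) (fun z => vol2 z.1 z.2 * ((1 - vol z.1) ^+ h * (1 - vol z.2) ^+ h)) <=
  2 * (survive k.+1 h 1 * (survive k.+2 h 1 - survive k.+2 h.+1 1)).
Proof.
have bS := bmeasM (@bmeas_fst_survive R k.+2 h) (@bmeas_snd_survive R k.+2 h).
have b1 := bmeasM bmeas_half bS.
have bhalf2 : bmeas (fun z => half (z.2, z.1)).
  by apply: (bmeas_comp (h := fun z : cubeT * cubeT => (z.2, z.1))) bmeas_half;
    exact: measurable_swap.
have b2 := bmeasM bhalf2 bS.
have m2 : mean (cube2 k.+2) (fun z => half (z.2, z.1) *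
      ((1 - vol z.1) ^+ h * (1 - vol z.2) ^+ h)) =
    mean (cube2 k.+2) (fun z => half z * ((1 - vol z.1) ^+ h * (1 - vol z.2) ^+ h)).
  rewrite (mean_swap _ b2); apply: eq_mean => -[x y] /=.
  by rewrite [_ ^+ h * _]mulrC.
apply: (@le_trans _ _ (mean (cube2 k.+2) (fun z =>
   half z * ((1 - vol z.1) ^+ h * (1 - vol z.2) ^+ h) +
   half (z.2, z.1) * ((1 - vol z.1) ^+ h * (1 - vol z.2) ^+ h)))).
  apply: le_mean.
  - by apply: bmeasM => //; exact: bmeas_vol2.
  - exact: bmeasD.
  move=> -[x y] /=; rewrite -mulrDl ler_wpM2r ?vol2_le_half//.
  have /andP[x0 x1] := onem_vol01 x; have /andP[y0 y1] := onem_vol01 y.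
  by rewrite mulr_ge0// exprn_ge0.
by rewrite meanD// m2 -mulr2n -[leLHS]mulr_natl ler_wpM2l// mean_half.
Qed.

(** With [S] as in the proof, [S - (1 - vol x) * (1 - vol y)] is [vol2 x y - vol x * vol y], hence
    at most [vol2 x y], and [subrX_le] bounds the difference of the [m]-th powers by
    [m * vol2 x y * S ^+ m.-1]. Since [S] is at most each of [1 - vol x] and [1 - vol y], spending
    [h] of its factors on each point separates the two again. *)
Lemma pair_survive_le m h : (h.*2 <= m.-1)%N ->
  pair_survive (R := R) k.+2 m <= survive k.+2 m 1 ^+ 2 +
    m%:R * (2 * (survive k.+1 h 1 * (survive k.+2 h 1 - survive k.+2 h.+1 1))).
Proof.
move=> hm.
have bSm := bmeasM (@bmeas_fst_survive R k.+2 m) (@bmeas_snd_survive R k.+2 m).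
have bSh := bmeasM (@bmeas_fst_survive R k.+2 h) (@bmeas_snd_survive R k.+2 h).
have bW := bmeasM (@bmeas_vol2 R k.+2) bSh.
apply: (@le_trans _ _ (mean (cube2 k.+2) (fun z =>
   (1 - vol z.1) ^+ m * (1 - vol z.2) ^+ m +
   m%:R * (vol2 z.1 z.2 * ((1 - vol z.1) ^+ h * (1 - vol z.2) ^+ h))))); last first.
  rewrite meanD//; last by apply: bmeasM => //; exact: bmeas_cst.
  by rewrite mean_survive2 meanZl// lerD2l ler_wpM2l// mean_vol2_survive.
apply: le_mean.
- by apply: bmeasM; [exact: bmeas_incomp|exact: bmeas_pair_survive].
- by apply: bmeasD => //; apply: bmeasM => //; exact: bmeas_cst.
move=> -[x y] /=.
have /andP[i0 i1] := incomp01 (x, y).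
have /andP[u0 u1] := onem_vol01 x; have /andP[v0 v1] := onem_vol01 y.
have S_ge := onem_mul_le x y.
set S := 1 - vol x - vol y + vol2 x y in S_ge *.
have UV0 := mulr_ge0 u0 v0.
have S0 : 0 <= S by exact: le_trans S_ge.
have Su : S <= 1 - vol x by have := vol2_ler x y; rewrite /S; lra.
have Sv : S <= 1 - vol y by have := vol2_lel x y; rewrite /S; lra.
apply: (@le_trans _ _ (S ^+ m)); first by rewrite ler_piMl// exprn_ge0.
rewrite -lerBlDl -exprMn (le_trans (subrX_le m UV0 S_ge))//.
rewrite -mulrA ler_wpM2l//; apply: ler_pM.
- by rewrite subr_ge0.
- exact: exprn_ge0.
- have /andP[] := vol01 x; have /andP[] := vol01 y; rewrite /S => ? ? ? ?; nra.
apply: (@le_trans _ _ (S ^+ h.*2)).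
  by rewrite ler_wiXn2l// (le_trans Su).
rewrite -addnn exprD; apply: ler_pM; rewrite ?exprn_ge0//;
  exact: lerXn2r.
Qed.

End pair_upper.

(** * Logarithmic asymptotics *)

Section log_bounds.
Context {R : realType}.

Lemma ln_ge1BV (x : R) : 0 < x -> 1 - x^-1 <= ln x.
Proof.
move=> x0; rewrite -lerN2 -lnV ?posrE// opprB.
rewrite -[X in ln X](subrKC 1) le_ln1Dx// ltrBrDr addNr invr_gt0//.
Qed.

Lemma ln_natS_diff_ge n : n.+2%:R^-1 <= ln n.+2%:R - ln n.+1%:R :> R.
Proof.
rewrite -ln_div ?posrE ?ltr0n//.
apply: le_trans (ln_ge1BV _); last by rewrite divr_gt0 ?ltr0n.
rewrite invf_div le_eqVlt; apply/orP; left; apply/eqP.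
have : 0 < n.+1%:R :> R by [].
rewrite -[n.+2%:R]natr1; set a := n.+1%:R => a0; field.
by apply: lt0r_neq0; lra.
Qed.

Lemma ln_natS_diff_le n : ln n.+2%:R - ln n.+1%:R <= n.+1%:R^-1 :> R.
Proof.
rewrite -ln_div ?posrE ?ltr0n//.
have -> : n.+2%:R / n.+1%:R = 1 + n.+1%:R^-1 :> R.
  by rewrite -[n.+2]addn1 natrD mulrDl mul1r divff// pnatr_eq0.
by apply: le_ln1Dx; rewrite (lt_le_trans (ltrN10 _))// invr_ge0.
Qed.

Lemma ln_nat_ge0 n : 0 <= ln n.+1%:R :> R.
Proof. by rewrite ln_ge0// ler1n. Qed.

Lemma ler_ln_nat n : ln n.+1%:R <= ln n.+2%:R :> R.
Proof. by rewrite ler_ln ?posrE ?ltr0n// ler_nat. Qed.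

(* By [sum_survive], [scaled j m] is the nested harmonic sum of [1/(i_1...i_j)]
   over [1 <= i_1 <= ... <= i_j <= m + 1]. *)
Definition scaled j m : R := m.+1%:R * survive j.+1 m 1.

Lemma survive_scaled j m : survive j.+1 m 1 = scaled j m / m.+1%:R.
Proof. by rewrite /scaled mulrC mulKf// pnatr_eq0. Qed.

Lemma scaled0 m : scaled 0 m = 1.
Proof.
rewrite /scaled sum_survive; under eq_bigr do rewrite survive0 subrr.
by rewrite big_ord_recl big1 ?addr0// => i _; rewrite expr0n.
Qed.

Lemma scaledS j m :
  scaled j.+1 m = \sum_(i < m.+1) scaled j i / i.+1%:R.
Proof.
by rewrite {1}/scaled sum_survive; apply: eq_bigr => i _; rewrite survive_scaled.
Qed.

Lemma scaled_mono j m n : (m <= n)%N -> scaled j m <= scaled j n.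
Proof.
move=> mn; rewrite /scaled !sum_survive (big_ord_widen n.+1 (fun i => survive j i 1))//.
rewrite big_mkcond /=; apply: ler_sum => i _; case: ifP => // _.
by rewrite survive_ge0// ler01 lexx.
Qed.

(** Discrete form of integrating [(ln t)^j / t]: each increment of the bound for [j + 1] is at most
    the corresponding term of the sum in [scaledS]. *)
Lemma scaled_ge j m : ln m.+2%:R ^+ j / j`!%:R <= scaled j m.
Proof.
elim: j m => [|j IHj] m; first by rewrite scaled0 expr0 fact0 divr1.
(* Generalizing the length lets the induction start from the empty sum, where [ln 1 = 0]. *)
rewrite scaledS; move: m.+1 => n {m}.
elim: n => [|n IHn]; first by rewrite ln1 expr0n mul0r big_ord0.
rewrite big_ord_recr -lerBlDr (le_trans _ IHn)// lerBlDr -lerBlDl -mulrBl.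
apply: (@le_trans _ _ (ln n.+2%:R ^+ j / j`!%:R / n.+1%:R)); last first.
  by rewrite ler_pM2r ?invr_gt0 ?ltr0n// IHj.
have j0 : 0 < j`!%:R :> R by rewrite ltr0n fact_gt0.
rewrite factS natrM ler_pdivrMr ?mulr_gt0 ?ltr0n ?fact_gt0//.
apply: le_trans (subrX_le _ (ln_nat_ge0 n) (ler_ln_nat n)) _.
rewrite [leRHS](_ : _ = j.+1%:R * n.+1%:R^-1 * ln n.+2%:R ^+ j); last first.
  by field; rewrite nat1r !pnatr_eq0 -!lt0n fact_gt0.
by rewrite ler_wpM2r ?exprn_ge0 ?ln_nat_ge0// ler_wpM2l// ln_natS_diff_le.
Qed.

(** The increment is bounded below at its left endpoint, while the new term involves the right one.
    The shift by [j] absorbs this: consecutive logarithms differ by at most [1], so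
    [j + ln (m + 2) <= (j + 1) + ln (m + 1)]. *)
Lemma scaled_le j m : scaled j m <= (j%:R + ln m.+1%:R) ^+ j / j`!%:R.
Proof.
elim: j m => [|j IHj] m; first by rewrite scaled0 expr0 fact0 divr1.
rewrite scaledS.
have nj : 0 < j`!%:R :> R by rewrite ltr0n fact_gt0.
elim: m => [|m IHm].
  rewrite big_ord1 divr1 (le_trans (IHj _))// ln1 !addr0.
  rewrite factS natrM exprS invfM mulrACA divff ?gt_eqF// mul1r.
  by rewrite ler_pM2r ?invr_gt0// lerXn2r ?nnegrE// ler_nat.
rewrite big_ord_recr /= -lerBrDr (le_trans IHm)// lerBrDr -lerBrDl -mulrBl.
set y := j.+1%:R + ln m.+1%:R; set x := j.+1%:R + ln m.+2%:R.
have y0 : 0 <= y by rewrite addr_ge0// ln_nat_ge0.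
have yx : y <= x by rewrite lerD2l ler_ln_nat.
have xy : x - y = ln m.+2%:R - ln m.+1%:R by rewrite /x /y; ring.
apply: (@le_trans _ _ (y ^+ j / j`!%:R / m.+2%:R)).
  rewrite ler_pM2r ?invr_gt0 ?ltr0n// (le_trans (IHj _))//.
  rewrite ler_pM2r ?invr_gt0// lerXn2r ?nnegrE ?addr_ge0 ?ln_nat_ge0//.
  rewrite /y -[j.+1%:R]natr1; have := ln_natS_diff_le m.
  have : m.+1%:R^-1 <= 1 :> R by rewrite invf_le1 ?ltr0n// ler1n.
  by move=> h1 h2; rewrite -addrA lerD2l -lerBlDr (le_trans h2).
rewrite factS natrM ler_pdivlMr ?mulr_gt0//.
apply: le_trans (subrX_ge j y0 yx).
rewrite [leLHS](_ : _ = j.+1%:R * m.+2%:R^-1 * y ^+ j); last first.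
  by field; rewrite -natrD !pnatr_eq0 -!lt0n fact_gt0.
by rewrite ler_wpM2r ?exprn_ge0// ler_wpM2l// xy ln_natS_diff_ge.
Qed.

Lemma scaled_gt0 j m : 0 < scaled j m.
Proof.
apply: lt_le_trans (scaled_ge j m).
by rewrite divr_gt0 ?ltr0n ?fact_gt0// exprn_gt0// ln_gt0// ltr1n.
Qed.

Lemma survive_gt0 j m : 0 < survive j.+1 m 1 :> R.
Proof. by rewrite survive_scaled divr_gt0 ?scaled_gt0 ?ltr0n. Qed.

Lemma survive_diff_ge0 k m : 0 <= survive k m 1 - survive k m.+1 1 :> R.
Proof.
rewrite -mean_vol_survive; apply: mean_ge0 => x.
have /andP[v0 v1] := onem_vol01 x; have /andP[w0 w1] := vol01 x.
by rewrite mulr_ge0// exprn_ge0.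
Qed.

(** In [surviveS] the term of lower dimension is nonnegative; dropping it bounds [(m + 1)] times the
    difference by the later value. *)
Lemma survive_diff_le k m :
  survive k.+1 m 1 - survive k.+1 m.+1 1 <= survive k.+1 m.+1 1 / m.+1%:R :> R.
Proof.
rewrite ler_pdivlMr ?ltr0n// mulrC mulrBr.
have h := surviveS k m (1 : R).
have : 0 <= survive k m.+1 1 :> R by rewrite survive_ge0// ler01 lexx.
by move: h; rewrite -[m.+2%:R]natr1 mulrDl mul1r; lra.
Qed.

End log_bounds.

Lemma half_pred_ge m : (m.+2 <= 4 * (m.-1./2).+1)%N.
Proof. by lia. Qed.

(** The constant is [2 * 4 * 4 ^ 2]. It is applied to [q = h + 1] with [h] about [m / 2], turning
    the denominators in [h] into powers of [m + 2]. *)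
Lemma cubic_le m q : (m.+2 <= 4 * q)%N ->
  (2 * m * m.+2 ^ 2 <= 128 * (q ^ 2 * q.+1))%N.
Proof.
move=> mq.
have m4q : (m <= 4 * q)%N by lia.
have mq2 : (m.+2 ^ 2 <= (4 * q) ^ 2)%N by rewrite leq_sqr.
apply: leq_trans (leq_mul (leq_mul (leqnn 2) m4q) mq2) _.
by rewrite -!mulnn; nia.
Qed.

Section asymptotics.
Context {R : realType}.
Variable j : nat.

(** Throughout the section [k = j + 2] and [n = m + 2], so that [p m], [e m] and [L m] stand for
    [p_n], [e_n] and [ln n]. *)
Local Notation p m := (survive j.+2 m.+1 (1 : R)).
Local Notation e m := (pair_survive (R := R) j.+2 m).
Local Notation L m := (ln m.+2%:R : R).

Let L_gt0 m : 0 < L m.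
Proof. by rewrite ln_gt0// ltr1n. Qed.

Let fact_gt0R n : 0 < n`!%:R :> R.
Proof. by rewrite ltr0n fact_gt0. Qed.

Let p_scaled m : m.+2%:R * p m = scaled j.+1 m.+1.
Proof. by []. Qed.

Lemma scaled_ratio m :
  1 <= m.+2%:R * p m * j.+1`!%:R / L m ^+ j.+1 <=
  (j.+1%:R / L m + 1) ^+ j.+1.
Proof.
have L0 := L_gt0 m; rewrite p_scaled.
rewrite ler_pdivlMr ?exprn_gt0// mul1r ler_pdivrMr ?exprn_gt0//.
rewrite -exprMn mulrDl mul1r divfK ?gt_eqF// -ler_pdivlMr//.
rewrite (scaled_le j.+1 m.+1) andbT -ler_pdivrMr//.
apply: le_trans (scaled_ge j.+1 m.+1).
by rewrite ler_pM2r ?invr_gt0// lerXn2r ?nnegrE ?ln_nat_ge0// ler_ln_nat.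
Qed.

(** The loss in [pair_survive_ge] is at most [2 p_n / (n - 1)]. The lower bound of [scaled_ratio]
    trades one factor [p_n] for [n], and [n <= 2 (n - 1)]; the constant [4] is the product of these
    two factors [2]. *)
Lemma pair_ratio_ge m :
  1 - 4 * j.+1`!%:R * (L m)^-1 ^+ j.+1 <= e m / p m ^+ 2.
Proof.
have L0 := L_gt0 m; have p0 : 0 < p m by exact: survive_gt0.
have /andP[h _] := scaled_ratio m.
have := pair_survive_ge (R := R) j.+2 m.
have := survive_diff_ge0 (R := R) j.+2 m; have := survive_diff_le (R := R) j.+1 m.
set s := survive j.+2 m 1 => d1 d2 lb.
rewrite ler_pdivlMr ?exprn_gt0//; apply: le_trans lb.
have m0 : 0 < m.+1%:R :> R by [].
have e1 : p m / m.+1%:R <= 2 * j.+1`!%:R * (L m)^-1 ^+ j.+1 * p m ^+ 2.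
  rewrite ler_pdivrMr// exprVn.
  rewrite ler_pdivlMr ?exprn_gt0// mul1r in h.
  rewrite [leRHS](_ : _ = p m * ((2 * m.+1%:R) * p m * j.+1`!%:R / L m ^+ j.+1)); last first.
    by field; rewrite expf_neq0// gt_eqF.
  rewrite ler_peMr ?(ltW p0)// ler_pdivlMr ?exprn_gt0// mul1r (le_trans h)//.
  rewrite ler_pM2r// ler_pM2r// -natrM ler_nat; lia.
have sp : p m ^+ 2 <= s ^+ 2.
  by rewrite lerXn2r ?nnegrE ?(ltW p0)//; move: d2; rewrite subr_ge0 //; apply: le_trans; exact: ltW.
have {}d1 := le_trans d1 e1.
rewrite mulrBl mul1r; move: d1 sp; set q := p m; set T := _ ^-1 ^+ _. lra.
Qed.

(** The square comes from [(n - 1) p_(n-1) <= n p_n], the monotonicity of [scaled]. The other term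
    comes from [128 * (a / b)], where [a] and [b] are nested harmonic sums of depth [j] and [j + 1]:
    their quotient is of order [1 / L m]. *)
Lemma pair_ratio_le m :
  e m / p m ^+ 2 <= (1 + m.+1%:R^-1) ^+ 2 +
    128 * (j.+1%:R * ((j%:R / L m + 1) ^+ j / L m)).
Proof.
have L0 := L_gt0 m; have p0 : 0 < p m by exact: survive_gt0.
have m0 : 0 < m.+1%:R :> R by [].
(* The largest [h] with [2 h <= m - 1]. For [m = 0] the truncated subtraction gives [h = 0], and the
   error term carries the factor [m]. *)
pose h := m.-1./2.
have hm : (h.*2 <= m.-1)%N by rewrite /h; lia.
have ub := pair_survive_le (R := R) j hm.
rewrite ler_pdivrMr ?exprn_gt0//; apply: le_trans ub _.
rewrite [leRHS]mulrDl; apply: lerD.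
  rewrite -exprMn lerXn2r ?nnegrE ?mulr_ge0 ?addr_ge0 ?invr_ge0 ?(ltW p0)//.
    by rewrite survive_ge0// ler01 lexx.
  have := scaled_mono (R := R) j.+1 (leqnSn m).
  rewrite /scaled -[m.+2%:R]natr1 => sm.
  rewrite -(ler_pM2l m0) (le_trans sm)// le_eqVlt; apply/orP; left; apply/eqP.
  by rewrite mulrA mulrDr mulr1 divff ?gt_eqF.
have d1 := survive_diff_le (R := R) j.+1 h.
have a1 := scaled_mono (R := R) j (_ : h <= m.+1)%N.
have b1 := scaled_mono (R := R) j.+1 (_ : h.+1 <= m.+1)%N.
set a := scaled j m.+1 in a1.
set b := scaled j.+1 m.+1 in b1.
have hm1 : (h <= m.+1)%N by lia.
have hm2 : (h.+1 <= m.+1)%N by lia.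
have {}a1 := a1 hm1; have {}b1 := b1 hm2.
have a0 : 0 < a by exact: scaled_gt0.
have b0 : 0 < b by exact: scaled_gt0.
have h1 : 0 < h.+1%:R :> R by [].
have h2 : 0 < h.+2%:R :> R by [].
have step1 : m%:R * (2 * (survive j.+1 h 1 * (survive j.+2 h 1 - survive j.+2 h.+1 1))) <=
    m%:R * (2 * (a / h.+1%:R * (b / h.+2%:R / h.+1%:R))).
  rewrite ler_wpM2l// ler_pM2l//; apply: ler_pM.
  - by rewrite ltW// survive_gt0.
  - exact: survive_diff_ge0.
  - by rewrite survive_scaled ler_pM2r ?invr_gt0.
  - apply: (le_trans d1); rewrite ler_pM2r ?invr_gt0//.
    by rewrite survive_scaled ler_pM2r ?invr_gt0.
apply: (le_trans step1).
have pE : p m = b / m.+2%:R by rewrite survive_scaled.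
have step2 : m%:R * (2 * (a / h.+1%:R * (b / h.+2%:R / h.+1%:R))) <=
    128 * (a / b) * p m ^+ 2.
  rewrite pE expr_div_n.
  rewrite [leLHS](_ : _ = 2 * m%:R / (h.+1%:R ^+ 2 * h.+2%:R) * (a * b)); last first.
    by field; rewrite nat1r -natrD !pnatr_eq0.
  rewrite [leRHS](_ : _ = 128 / m.+2%:R ^+ 2 * (a * b)); last first.
    by field; rewrite (gt_eqF b0) -natrD pnatr_eq0.
  rewrite (ler_pM2r (mulr_gt0 a0 b0)).
  rewrite ler_pdivrMr ?mulr_gt0 ?exprn_gt0// mulrAC ler_pdivlMr ?exprn_gt0//.
  rewrite -!natrX -!natrM ler_nat.
  exact: cubic_le (half_pred_ge m).
apply: (le_trans step2); rewrite ler_pM2r ?exprn_gt0// ler_pM2l//.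
have aU : a <= (j%:R + L m) ^+ j / j`!%:R by exact: scaled_le.
have bL : L m ^+ j.+1 / j.+1`!%:R <= b.
  apply: le_trans (scaled_ge j.+1 m.+1).
  by rewrite ler_pM2r ?invr_gt0// lerXn2r ?nnegrE ?ln_nat_ge0// ler_ln_nat.
rewrite ler_pdivrMr//; apply: (le_trans aU).
apply: (@le_trans _ _ (j.+1%:R * ((j%:R / L m + 1) ^+ j / L m) *
    (L m ^+ j.+1 / j.+1`!%:R))); last first.
  rewrite ler_wpM2l// mulr_ge0// divr_ge0 ?(ltW L0)// exprn_ge0//.
  by rewrite addr_ge0// divr_ge0 ?(ltW L0).
rewrite le_eqVlt; apply/orP; left; apply/eqP.
have -> : j%:R + L m = (j%:R / L m + 1) * L m.
  by rewrite mulrDl mul1r divfK ?gt_eqF.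
rewrite factS natrM exprMn exprS; set A := (_ + 1) ^+ j; set B := _ ^+ j.
by field; rewrite nat1r (gt_eqF (fact_gt0R j)) (gt_eqF L0) pnatr_eq0.
Qed.

End asymptotics.

(** * Limits of the ratios and of the correlation *)

Section limits.
Context {R : realType}.

Lemma cvg_ln_nat : (ln n%:R : R) @[n --> \oo] --> +oo.
Proof.
apply/cvgryPge => A; near=> n.
rewrite -[A]expRK ler_ln ?posrE ?expR_gt0//.
  by near: n; exact: nbhs_infty_ger.
by apply: lt_le_trans (expR_gt0 A) _; near: n; exact: nbhs_infty_ger.
Unshelve. all: by end_near. Qed.

Lemma cvg_lnV_nat : (ln n%:R : R)^-1 @[n --> \oo] --> (0 : R).
Proof.
apply/gtr0_cvgV0; last exact: cvg_ln_nat.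
near=> n; rewrite ln_gt0// ltr1n; near: n; exact: nbhs_infty_gt.
Unshelve. all: by end_near. Qed.

Lemma cvgX (u : nat -> R) (l : R) q :
  u n @[n --> \oo] --> l -> u n ^+ q @[n --> \oo] --> l ^+ q.
Proof.
move=> ul.
exact: continuous_cvg (@exprn_continuous R q l) ul.
Qed.

Lemma cvg_affineX (t : nat -> R) (c : R) q : t n @[n --> \oo] --> (0 : R) ->
  (c * t n + 1) ^+ q @[n --> \oo] --> (1 : R).
Proof.
move=> t0; rewrite [X in _ --> X](_ : _ = (c * 0 + 1) ^+ q); last first.
  by rewrite mulr0 add0r expr1n.
apply: cvgX; apply: cvgD; last exact: cvg_cst.
by apply: cvgM => //; exact: cvg_cst.
Qed.

(** The [q]-th power of [x / q <= exp (x / q)] at [x = ln (n + 1)]. *)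
Lemma ln_powS_le n q : ln n.+1%:R ^+ q <= q%:R ^+ q * n.+1%:R :> R.
Proof.
case: q => [|q]; first by rewrite !expr0 mul1r ler1n.
have n0 : 0 < n.+1%:R :> R by [].
rewrite -{2}[n.+1%:R]lnK ?posrE//.
set x := ln _; have x0 : 0 <= x by exact: ln_nat_ge0.
have -> : expR x = expR (x / q.+1%:R) ^+ q.+1.
  by rewrite -expRM_natl mulrC divfK// pnatr_eq0.
rewrite -exprMn lerXn2r ?nnegrE ?mulr_ge0 ?expR_ge0//.
rewrite mulrC -ler_pdivrMr//.
by apply: le_trans (expR_ge1Dx _); rewrite lerDr.
Qed.

Section ratios.
(** The sequences are known only from index [2] on, where the sample is assumed i.i.d.; their first
    two values are arbitrary and do not affect the limits. *)
Variables (j : nat) (p e rho : nat -> R).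
Hypothesis pE : forall m, p m.+2 = survive j.+2 m.+1 1.
Hypothesis eE : forall m, e m.+2 = pair_survive j.+2 m.
Hypothesis rhoE : forall m, rho m.+2 =
  (e m.+2 - p m.+2 ^+ 2) / (p m.+2 - p m.+2 ^+ 2).

Let g n : R := ln n%:R ^+ j.+1 / n%:R.

Let L_gt0 m : 0 < ln m.+2%:R :> R.
Proof. by rewrite ln_gt0// ltr1n. Qed.

Lemma cvg_pair_ratio : e n / p n ^+ 2 @[n --> \oo] --> (1 : R).
Proof.
have t0 := cvg_lnV_nat.
apply: (@squeeze_cvgr _ _ _ _
  (fun n => 1 - 4 * j.+1`!%:R * (ln n%:R)^-1 ^+ j.+1)
  (fun n => (1 * n.-1%:R^-1 + 1) ^+ 2 +
     128 * (j.+1%:R * ((j%:R * (ln n%:R)^-1 + 1) ^+ j * (ln n%:R)^-1)))).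
- exists 2%N => // -[|[|m]]// _; rewrite eE pE pair_ratio_ge /=.
  by rewrite mul1r [_^-1 + 1]addrC pair_ratio_le.
- rewrite -[X in _ --> X]subr0; apply: cvgB; first exact: cvg_cst.
  rewrite -(mulr0 (4 * j.+1`!%:R)); apply: cvgM; first exact: cvg_cst.
  by have := cvgX (q := j.+1) t0; rewrite expr0n.
- rewrite -[X in _ --> X]addr0; apply: cvgD.
    apply: cvg_affineX.
    rewrite -cvg_shiftS /=.
    apply/gtr0_cvgV0; last exact: cvgr_idn.
    by near=> n; rewrite ltr0n; near: n; exact: nbhs_infty_gt.
  rewrite -(mulr0 128); apply: cvgM; first exact: cvg_cst.
  rewrite -(mulr0 j.+1%:R); apply: cvgM; first exact: cvg_cst.
  rewrite -(mulr0 1); apply: cvgM => //.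
  exact: cvg_affineX.
Unshelve. all: by end_near. Qed.

Lemma cvg_scaled_ratio :
  n%:R * p n * j.+1`!%:R / ln n%:R ^+ j.+1 @[n --> \oo] --> (1 : R).
Proof.
apply: (@squeeze_cvgr _ _ _ _ (fun=> 1)
  (fun n => (j.+1%:R * (ln n%:R)^-1 + 1) ^+ j.+1)).
- by exists 2%N => // -[|[|m]]// _; rewrite pE scaled_ratio.
- exact: cvg_cst.
- by apply: cvg_affineX; exact: cvg_lnV_nat.
Unshelve. all: by end_near. Qed.

Lemma cvg_log_ratio :
  p n ^+ 2 / (ln n%:R ^+ j.+1 / (n%:R * j.+1`!%:R)) ^+ 2 @[n --> \oo] --> (1 : R).
Proof.
have := cvgX (q := 2) cvg_scaled_ratio.
rewrite expr1n; apply: cvg_trans; apply: near_eq_cvg.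
exists 2%N => // -[|[|m]]// _ /=.
rewrite -expr_div_n; congr (_ ^+ 2).
have := L_gt0 m; set L := ln _ => L0.
have : m.+2%:R != 0 :> R by rewrite pnatr_eq0.
have : j.+1`!%:R != 0 :> R by rewrite pnatr_eq0 -lt0n fact_gt0.
have : L ^+ j.+1 != 0 by rewrite expf_neq0// gt_eqF.
move: (L ^+ _) (_`!%:R) (m.+2%:R) => A B C A0 B0 C0.
by field; rewrite A0 B0 C0.
Unshelve. all: by end_near. Qed.

(** One logarithm more than in [g] is still at most a constant times [n] by [ln_powS_le], hence the
    majorant of order [1 / ln n]. *)
Lemma cvg_g0 : g n @[n --> \oo] --> (0 : R).
Proof.
apply: (@squeeze_cvgr _ _ _ _ (fun=> 0)
  (fun n => j.+2%:R ^+ j.+2 * (ln n%:R)^-1)).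
- exists 2%N => // -[|[|m]]// _; rewrite /g.
  have L0 := L_gt0 m.
  rewrite divr_ge0 ?exprn_ge0 ?(ltW L0)//= ler_pdivrMr//.
  rewrite mulrAC ler_pdivlMr// -exprSr.
  exact: ln_powS_le.
- exact: cvg_cst.
- rewrite -(mulr0 (j.+2%:R ^+ j.+2)); apply: cvgM; first exact: cvg_cst.
  exact: cvg_lnV_nat.
Unshelve. all: by end_near. Qed.

(** The correlation is [(e / p^2 - 1) * (p / (1 - p))]. Eventually [p <= 2 g] and [g < 1 / 4], so
    [p <= 1 / 2] and the second factor is at most [4 g]; this is why the first is required to be
    below [eps / 4]. *)
Lemma rho_littleo : rho =o_\oo g.
Proof.
apply/eqoP => eps eps0.
suff H m : m.+2%:R * p m.+2 * j.+1`!%:R / ln m.+2%:R ^+ j.+1 < 2 ->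
    g m.+2 < 4^-1 -> `|1 - e m.+2 / p m.+2 ^+ 2| < eps / 4 ->
    `|rho m.+2| <= eps * `|g m.+2|.
  have r2 : \forall n \near \oo,
      n%:R * p n * j.+1`!%:R / ln n%:R ^+ j.+1 < 2.
    by apply: (cvgr_lt _ cvg_scaled_ratio); rewrite ltr1n.
  have g4 : \forall n \near \oo, g n < 4^-1.
    by apply: (cvgr_lt _ cvg_g0); rewrite invr_gt0.
  have e1 : \forall n \near \oo, `|1 - e n / p n ^+ 2| < eps / 4.
    by apply: (@pseudometric_normed_Zmodule.cvgr_dist_lt _ R^o _ _ _ _ _ cvg_pair_ratio); rewrite divr_gt0.
  have n2 : \forall n \near \oo, (2 <= n)%N by exact: nbhs_infty_ge.
  apply: filterS3 (filterI n2 r2) g4 e1 => -[|[|m]] [] // _ h1 h2 h3.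
  exact: H.
move=> h1 h2 h3.
have L0 : 0 < ln m.+2%:R ^+ j.+1 :> R by rewrite exprn_gt0.
have p0 : 0 < p m.+2 by rewrite pE survive_gt0.
have g0 : 0 < g m.+2 by rewrite divr_gt0.
have p2g : p m.+2 <= 2 * g m.+2.
  rewrite /g mulrA ler_pdivlMr// mulrC.
  move: h1; rewrite ltr_pdivrMr// => /ltW; apply: le_trans.
  by rewrite ler_peMr ?mulr_ge0 ?(ltW p0)// ler1n fact_gt0.
have p12 : p m.+2 <= 2^-1 by lra.
rewrite rhoE [`|g _|]gtr0_norm//.
have -> : (e m.+2 - p m.+2 ^+ 2) / (p m.+2 - p m.+2 ^+ 2) =
    (e m.+2 / p m.+2 ^+ 2 - 1) * (p m.+2 / (1 - p m.+2)).
  field; rewrite (gt_eqF p0) /=; apply/andP; split.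
    by rewrite gt_eqF//; lra.
  by rewrite gt_eqF// expr2 -{1}[p m.+2]mulr1 -mulrBr mulr_gt0//; lra.
rewrite normrM distrC.
have q0 : 0 <= p m.+2 / (1 - p m.+2) by rewrite divr_ge0 ?(ltW p0)//; lra.
rewrite (ger0_norm q0).
have q4 : p m.+2 / (1 - p m.+2) <= 4 * g m.+2.
  rewrite ler_pdivrMr; last lra.
  have : 4 * g m.+2 * 2^-1 <= 4 * g m.+2 * (1 - p m.+2).
    by rewrite ler_wpM2l ?mulr_ge0 ?(ltW g0)//; lra.
  by apply: le_trans; lra.
have -> : eps * g m.+2 = eps / 4 * (4 * g m.+2) by field.
by apply: ler_pM => //; exact: ltW.
Qed.

End ratios.
End limits.

(** * Events of the sample *)

Section correlation.
Context {d : measure_display} {T : measurableType d} {R : realType}.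
Variable P : probability T R.

Lemma fine_covariance (U V : T -> R) : bmeas U -> bmeas V ->
  fine (covariance P U V) = mean P (fun w => U w * V w) - mean P U * mean P V.
Proof.
move=> bU bV; rewrite covariance.unlock expectation.unlock.
transitivity (mean P (fun w => (U w - mean P U) * (V w - mean P V))) => //.
have bc (c : R) : bmeas (fun _ : T => c) by exact: bmeas_cst.
have bUV := bmeasM bU bV.
rewrite (eq_mean _ (g := fun w => U w * V w - mean P V * U w -
    mean P U * V w + mean P U * mean P V)); last by move=> w; ring.
rewrite meanD//; last by apply: bmeasB; [apply: bmeasB|]; rewrite //; exact: bmeasM.
rewrite meanB//; [|by apply: bmeasB => //; exact: bmeasM|exact: bmeasM].
rewrite meanB//; last exact: bmeasM.
by rewrite !meanZl// mean_cst; ring.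
Qed.

(** Both indicators have variance [q - q^2], so the product of their standard deviations is this
    variance. *)
Lemma corr_indic (A B : set T) (q r : R) : measurable A -> measurable B ->
  fine (P A) = q -> fine (P B) = q -> fine (P (A `&` B)) = r ->
  corr P (\1_A) (\1_B) = (r - q ^+ 2) / (q - q ^+ 2).
Proof.
move=> mA mB PA PB PAB.
have bA := bmeas_indic (R := R) mA; have bB := bmeas_indic (R := R) mB.
have cov (C D : set T) : measurable C -> measurable D ->
    mean P (fun w => \1_C w * \1_D w) = fine (P (C `&` D)).
  move=> mC mD; rewrite -mean_indic; last exact: measurableI.
  by apply: eq_mean => w; rewrite indicI.
rewrite /corr /variance !fine_covariance// !cov// !mean_indic// !setIid PA PB PAB.
have q01 : 0 <= q <= 1.
  rewrite -PA -mean_indic//; apply/andP; split; first exact: mean_ge0.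
  rewrite -[leRHS](mean_cst P); apply: le_mean => //; exact: bmeas_cst.
rewrite -expr2 -[Num.sqrt _ * _]expr2 sqr_sqrtr -?expr2//.
by have /andP[? ?] := q01; rewrite subr_ge0 expr2 ler_piMr.
Qed.

End correlation.

Section maxima_probabilities.
Context {R : realType} {d : measure_display} {T : measurableType d}.
Variables (k : nat) (P : probability T R) (X : nat -> {RV P >-> k.-tuple R}).

Lemma max_eventE n i : max_event X n i = maximal (@precb R k) X n i.
Proof.
by apply/seteqP; split => w Aw l ln li; have := Aw l ln li; apply: contra_not;
  move/precP.
Qed.

Lemma prob_max1 n (Y : nat -> {RV P >-> k.-tuple R}) :
  mutually_independent P n.+1 Y ->
  (forall i, (1 <= i <= n.+1)%N -> has_law (Y i) (uniform_cube k)) ->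
  fine (P (maximal (@precb R k) Y n.+1 1)) = survive k n 1.
Proof.
move=> indep law; rewrite (prob_maximal1 (@bmeas_prec12 R k) indep law).
by rewrite survive1E; apply: eq_mean => x; rewrite mean_prec.
Qed.

Variable n : nat.
Hypothesis iid : iid_uniform_cube n.+2 X.

Lemma measurable_max_event1 : measurable (max_event X n.+2 1).
Proof. by rewrite max_eventE; exact: (measurable_maximal1 (@bmeas_prec12 R k)). Qed.

Lemma measurable_max_event2 : measurable (max_event X n.+2 2).
Proof.
rewrite max_eventE -maximal_swap12//.
exact: (measurable_maximal1 (@bmeas_prec12 R k)).
Qed.

Lemma prob_max_event1 : fine (P (max_event X n.+2 1)) = survive k n.+1 1.
Proof. by case: iid => indep law; rewrite max_eventE prob_max1. Qed.

Lemma prob_max_event2 : fine (P (max_event X n.+2 2)) = survive k n.+1 1.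
Proof.
case: iid => indep law; rewrite max_eventE -maximal_swap12// prob_max1//.
  exact: mutually_independent_swap12.
by move=> i i2; apply: law; exact: swap12_le.
Qed.

Lemma prob_max_event12 :
  fine (P (max_event X n.+2 1 `&` max_event X n.+2 2)) = pair_survive k n.
Proof.
case: iid => indep law; rewrite !max_eventE.
rewrite (prob_maximal12 (@bmeas_prec12 R k) indep law) /pair_survive mean_fubini.
  apply: eq_mean => x; apply: eq_mean => y /=.
  by rewrite !mean_prec mean_prec2.
by apply: bmeasM; [exact: bmeas_incomp|exact: bmeas_pair_survive].
Qed.

End maxima_probabilities.

Lemma pair_surviveE (R : realType) k n : (0 < k)%N ->
  pair_survive k n =
  \sum_(a < n.+1) \sum_(b < n.+1) \sum_(c < n.+1)
    \sum_(f < n.+1 | (a + b + c + f == n)%N)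
      (-1) ^+ (a + b) * (n`!%:R / (a`! * b`! * c`! * f`!)%:R) *
      (((a + b + 2 * c + 2)%:R ^+ k - (b + c + 1)%:R ^+ k
          - (a + c + 1)%:R ^+ k) /
       ((a + c + 1)%:R ^+ k * (b + c + 1)%:R ^+ k
          * (a + b + c + 2)%:R ^+ k)) :> R.
Proof.
move=> k0.
pose coef (a b c f : nat) : R :=
  (-1) ^+ (a + b) * (n`!%:R / (a`! * b`! * c`! * f`!)%:R).
pose G (a b c f : nat) (z : k.-tuple R * k.-tuple R) : R :=
  coef a b c f * (incomp z * volM a b c z).
have bIV a b c : bmeas (fun z : k.-tuple R * k.-tuple R => incomp z * volM a b c z).
  by apply: bmeasM; [exact: bmeas_incomp|exact: bmeas_volM].
have bG a b c f : bmeas (G a b c f).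
  by apply: bmeasM => //; exact: bmeas_cst.
rewrite /pair_survive (eq_mean _ (g := fun z =>
  \sum_(a < n.+1) \sum_(b < n.+1) \sum_(c < n.+1)
    \sum_(f < n.+1 | (a + b + c + f == n)%N) G a b c f z)); last first.
  move=> z.
  (* The constant [1] is placed last so that its exponent [f] enters only through the constraint on
     the sum. The two negative terms produce the sign [(-1) ^+ (a + b)]. *)
  have -> : 1 - vol z.1 - vol z.2 + vol2 z.1 z.2 =
      - vol z.1 + (- vol z.2 + (vol2 z.1 z.2 + 1)) by ring.
  rewrite exprD4n; do 4 (rewrite big_distrr /=; apply: eq_bigr => ? _).
  rewrite /G /coef /volM expr1n exprD -[- vol z.1]mulN1r -[- vol z.2]mulN1r.
  by rewrite !exprMn; ring.
rewrite mean_sum => [|a]; last by do 3 apply: bmeas_sum => ?.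
apply: eq_bigr => a _; rewrite mean_sum => [|b]; last by do 2 apply: bmeas_sum => ?.
apply: eq_bigr => b _; rewrite mean_sum => [|c]; last by apply: bmeas_sum => ?.
apply: eq_bigr => c _; rewrite mean_sum//.
by apply: eq_bigr => f _; rewrite meanZl// mean_volM_incomparable.
Qed.

Theorem theorem3 (R : realType) (k : nat) (hk : (1 <= k)%N)
    (d : nat -> measure_display)
    (T : forall n : nat, measurableType (d n))
    (P : forall n : nat, probability (T n) R)
    (X : forall n : nat, nat -> {RV (P n) >-> k.-tuple R})
    (hX : forall n : nat, (2 <= n)%N -> iid_uniform_cube n (X n)) :
  let E := fun n i : nat => max_event (X n) n i in
  let p := fun n : nat => fine (P n (E n 1%N)) in
  let e := fun n : nat => fine (P n (E n 1%N `&` E n 2%N)) in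
  let rho := fun n : nat => corr (P n) (\1_(E n 1%N)) (\1_(E n 2%N)) in
  (forall n : nat, (2 <= n)%N ->
     e n =
     \sum_(a < n.-1) \sum_(b < n.-1) \sum_(c < n.-1)
       \sum_(f < n.-1 | (a + b + c + f == n - 2)%N)
         (-1) ^+ (a + b) *
         ((n - 2)`!%:R / (a`! * b`! * c`! * f`!)%:R) *
         (((a + b + 2 * c + 2)%:R ^+ k - (b + c + 1)%:R ^+ k
             - (a + c + 1)%:R ^+ k) /
          ((a + c + 1)%:R ^+ k * (b + c + 1)%:R ^+ k
             * (a + b + c + 2)%:R ^+ k))) /\
  ((1 < k)%N ->
     [/\ asymp_equiv e (fun n => p n ^+ 2),
         asymp_equiv (fun n => p n ^+ 2)
           (fun n => (ln n%:R ^+ k.-1 / (n%:R * (k.-1)`!%:R)) ^+ 2) &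
         rho =o_\oo (fun n : nat => ln n%:R ^+ k.-1 / n%:R : R)]).
Proof.
move=> E p e rho.
have pE m : p m.+2 = survive k m.+1 1.
  exact: prob_max_event1 (hX m.+2 isT).
have eE m : e m.+2 = pair_survive k m.
  exact: prob_max_event12 (hX m.+2 isT).
have rhoE m : rho m.+2 = (e m.+2 - p m.+2 ^+ 2) / (p m.+2 - p m.+2 ^+ 2).
  apply: corr_indic => //; first exact: measurable_max_event1.
    exact: measurable_max_event2.
  by rewrite pE; exact: prob_max_event2 (hX m.+2 isT).
split.
  by move=> [|[|n]]// _; rewrite eE !subSS subn0 pair_surviveE.
case: k {hk} P X hX E p e rho pE eE rhoE => [|[|j]]// P X hX E p e rho pE eE rhoE _.
split; [exact: cvg_pair_ratio pE eE|exact: cvg_log_ratio pE|].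
exact: rho_littleo pE eE rhoE.
Qed.
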